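(* Let $k$ be an algebraically closed field of characteristic zero and let $d\geq 2$ be an integer. Then: (a) for every integer $m$ with $0\leq m\leq d-1$ there exist $g$ and $\tau$ such that $T_{g,\tau}$ is a Cremona transformation of $\mathbb{P}^3$ of bidegree $(d,\,2d-1-m)$; (b) for all integers $\ell,m$ with $0\leq \ell<d-1$ and $0\leq m\leq 2d-2$ there exist $g$ and $\tau$ such that $T_{g,\tau}$ is a Cremona transformation of $\mathbb{P}^3$ of bidegree $(d,\,d^2-\ell^2-m)$. Here $g$ ranges over the irreducible homogeneous polynomials of degree $d$ of the form $g=wA(x,y,z)+B(x,y,z)$, $\tau=(t_1:t_2:t_3)$ ranges over the plane Cremona transformations associated to $2d-1$ points of $\mathbb{P}^2$ satisfying condition (I), and $T_{g,\tau}=(g:t_1:t_2:t_3)$, as defined in the context.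
   Context: $\mathbb{P}^3$ and $\mathbb{P}^2$ are projective spaces over $k$, with homogeneous coordinates $w,x,y,z$ on $\mathbb{P}^3$ and $x,y,z$ on $\mathbb{P}^2$, the latter identified with the plane $\{w=0\}\subset\mathbb{P}^3$. A Cremona transformation of $\mathbb{P}^n$ is a birational map $\mathbb{P}^n\dashrightarrow\mathbb{P}^n$. A Cremona transformation $F$ of $\mathbb{P}^3$ has bidegree $(d,e)$ if $F$ and its inverse $F^{-1}$ are defined by homogeneous polynomials, without non-trivial common factors, of degrees $d$ and $e$ respectively. For a curve $X\subset\mathbb{P}^2$ and a point $p$, $\mathrm{mult}_p(X)$ denotes the multiplicity of $X$ at $p$. Condition (I), for points $p_0,p_1,\ldots,p_{2d-2}\in\mathbb{P}^2$ (with $d\ge 2$): there exist curves $X_d,Y_{d-1}\subset\mathbb{P}^2$ of degrees $d$ and $d-1$ respectively, with $X_d$ irreducible, such that $\mathrm{mult}_{p_0}(X_d)=d-1$, $\mathrm{mult}_{p_0}(Y_{d-1})\geq d-2$, and $p_i\in X_d\cap Y_{d-1}$ for $i=1,\ldots,2d-2$. A plane Cremona transformation $\tau=(t_1:t_2:t_3):\mathbb{P}^2\dashrightarrow\mathbb{P}^2$ is said to be associated to points $p_0,\ldots,p_{2d-2}$ satisfying condition (I) if $t_1,t_2,t_3\in k[x,y,z]$ are homogeneous of degree $d$ without non-trivial common factors, and the linear system defining $\tau$ has a point of multiplicity $d-1$ at $p_0$ and passes through $p_1,\ldots,p_{2d-2}$ with multiplicity $1$. (For example, if $p_0=(1:0:0)$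 and $X_d$, $Y_{d-1}$ as in condition (I) have equations $t_1=0$ and $f=0$, then $(t_1:yf:zf)$ is such a transformation.) For an irreducible homogeneous polynomial $g=wA(x,y,z)+B(x,y,z)$ of degree $d$, with $A,B\in k[x,y,z]$ homogeneous of degrees $d-1$ and $d$, where $g$ vanishes at $(1:0:0:0)$ with order $d-1$ (i.e. $A\neq 0$), and for $\tau=(t_1:t_2:t_3)$ associated to $2d-1$ points satisfying condition (I), $T_{g,\tau}$ denotes the Cremona transformation $T_{g,\tau}=(g:t_1:t_2:t_3):\mathbb{P}^3\dashrightarrow\mathbb{P}^3$. *)

(* Defs.v *)
From mathcomp Require Import all_boot all_order all_algebra.
From mathcomp Require Export mpoly.

Set Implicit Arguments.
Unset Strict Implicit.
Unset Printing Implicit Defensive.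

Import GRing.Theory.
Local Open Scope ring_scope.

(** * Divisibility in polynomial rings *)

Definition mpoly_divides (k : fieldType) (n : nat) (q f : {mpoly k[n]}) : Prop :=
  exists r : {mpoly k[n]}, f = q * r.

Definition mpoly_irreducible (k : fieldType) (n : nat) (f : {mpoly k[n]}) : Prop :=
  [/\ f != 0, f \isn't a GRing.unit
    & forall q r : {mpoly k[n]},
        f = q * r -> q \is a GRing.unit \/ r \is a GRing.unit].

Definition no_common_factor (k : fieldType) (n m : nat)
    (F : m.-tuple {mpoly k[n]}) : Prop :=
  forall q : {mpoly k[n]},
    (forall i, mpoly_divides q (tnth F i)) -> q \is a GRing.unit.

Definition homogeneous_tuple (k : fieldType) (n m D : nat)
    (F : m.-tuple {mpoly k[n]}) : Prop :=
  forall i, tnth F i \is D.-homog.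

(** * Rational maps of P^n to itself

    The rational map (F_0 : ... : F_n) is represented by the tuple F.  Distinct
    tuples may represent the same rational map, see [same_ratmap]. *)

Definition is_ratmap (k : fieldType) (n : nat)
    (F : n.+1.-tuple {mpoly k[n.+1]}) : Prop :=
  (exists D, homogeneous_tuple D F) /\ (exists i, tnth F i != 0).

Definition same_ratmap (k : fieldType) (n : nat)
    (F G : n.+1.-tuple {mpoly k[n.+1]}) : Prop :=
  [/\ is_ratmap F, is_ratmap G
    & forall i j, tnth F i * tnth G j = tnth F j * tnth G i].

Definition id_ratmap (k : fieldType) (n : nat) : n.+1.-tuple {mpoly k[n.+1]} :=
  [tuple 'X_i | i < n.+1].

(* [G] after [F]; as a rational map it is defined only if the result is not
   identically zero. *)
Definition comp_ratmap (k : fieldType) (n : nat)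
    (G F : n.+1.-tuple {mpoly k[n.+1]}) : n.+1.-tuple {mpoly k[n.+1]} :=
  [tuple tnth G i \mPo F | i < n.+1].

Definition inverse_ratmaps (k : fieldType) (n : nat)
    (F G : n.+1.-tuple {mpoly k[n.+1]}) : Prop :=
  [/\ is_ratmap F, is_ratmap G,
      same_ratmap (comp_ratmap G F) (id_ratmap k n)
    & same_ratmap (comp_ratmap F G) (id_ratmap k n)].

Definition cremona (k : fieldType) (n : nat)
    (F : n.+1.-tuple {mpoly k[n.+1]}) : Prop :=
  exists G, inverse_ratmaps F G.

Definition ratmap_degree (k : fieldType) (n : nat)
    (F : n.+1.-tuple {mpoly k[n.+1]}) (D : nat) : Prop :=
  exists F' : n.+1.-tuple {mpoly k[n.+1]},
    [/\ same_ratmap F F', homogeneous_tuple D F' & no_common_factor F'].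

Definition cremona_of_bidegree (k : fieldType) (n : nat)
    (F : n.+1.-tuple {mpoly k[n.+1]}) (d e : nat) : Prop :=
  exists G, [/\ inverse_ratmaps F G, ratmap_degree F d & ratmap_degree G e].

(** * Points of P^n, given by nonzero row vectors, and multiplicities *)

(* Nonzero row vectors define the same point iff they span the same line. *)
Definition distinct_points (k : fieldType) (n r : nat)
    (p : 'I_r -> 'rV[k]_n.+1) : Prop :=
  (forall i, p i != 0) /\ (forall i j, i != j -> ~~ (p i == p j)%MS).

Definition on_hypersurface (k : fieldType) (n : nat)
    (F : {mpoly k[n.+1]}) (p : 'rV[k]_n.+1) : Prop :=
  F.@[p 0] = 0.

(* Degree of the lowest nonzero homogeneous part (0 if f = 0); the default value
   [msize f] exceeds the degree of every monomial of f. *)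
Definition lowest_degree (k : fieldType) (n : nat) (f : {mpoly k[n]}) : nat :=
  \big[minn/msize f]_(m <- msupp f) mdeg m.

Definition chart_at (k : fieldType) (n : nat) (p : 'rV[k]_n.+1) : 'I_n.+1 :=
  odflt ord0 [pick i | p 0 i != 0].

(* Equation of F = 0 in the affine chart X_i = p_i (p_i != 0), with the origin
   moved to p; the variable 'X_i does not occur in it. *)
Definition local_equation (k : fieldType) (n : nat)
    (F : {mpoly k[n.+1]}) (p : 'rV[k]_n.+1) : {mpoly k[n.+1]} :=
  F \mPo [tuple (p 0 j)%:MP + (if j == chart_at p then 0 else 'X_j) | j < n.+1].

Definition mult (k : fieldType) (n : nat)
    (F : {mpoly k[n.+1]}) (p : 'rV[k]_n.+1) : nat :=
  lowest_degree (local_equation F p).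

(* Multiplicity at p of the linear system spanned by the entries of F, i.e. the
   multiplicity of its general member: the minimum over all members. *)
Definition linear_system_mult (k : fieldType) (n m : nat)
    (F : m.-tuple {mpoly k[n.+1]}) (p : 'rV[k]_n.+1) (r : nat) : Prop :=
  let member (a : 'rV[k]_m) := \sum_(i < m) a 0 i *: tnth F i in
  (forall a, member a != 0 -> (r <= mult (member a) p)%N) /\
  (exists2 a, member a != 0 & mult (member a) p = r).

(** * The transformations T_{g,tau}

    The variables of {mpoly k[3]} are x, y, z (in this order) and those of
    {mpoly k[4]} are w, x, y, z. *)

(* A plane curve is given by an equation, up to a nonzero scalar; it may be
   reducible or nonreduced. *)
Definition plane_curve (k : fieldType) (D : nat) (X : {mpoly k[3]}) : Prop :=
  X != 0 /\ X \is D.-homog.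

(* The point p_0 is [p ord0]; the points p_1, ..., p_{2d-2} are the
   [p (lift ord0 i)]. *)
Definition condition_I (k : fieldType) (d : nat)
    (p : 'I_(2 * d - 2).+1 -> 'rV[k]_3) : Prop :=
  exists X Y : {mpoly k[3]},
    [/\ plane_curve d X /\ mpoly_irreducible X, plane_curve (d - 1) Y,
        mult X (p ord0) = (d - 1)%N, (d - 2 <= mult Y (p ord0))%N
      & forall i : 'I_(2 * d - 2),
          on_hypersurface X (p (lift ord0 i)) /\
          on_hypersurface Y (p (lift ord0 i))].

Definition associated (k : fieldType) (d : nat)
    (p : 'I_(2 * d - 2).+1 -> 'rV[k]_3) (tau : 3.-tuple {mpoly k[3]}) : Prop :=
  [/\ cremona tau, homogeneous_tuple d tau, no_common_factor tau,
      linear_system_mult tau (p ord0) (d - 1)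
    & forall i : 'I_(2 * d - 2), linear_system_mult tau (p (lift ord0 i)) 1].

Definition admissible_tau (k : fieldType) (d : nat)
    (tau : 3.-tuple {mpoly k[3]}) : Prop :=
  exists p : 'I_(2 * d - 2).+1 -> 'rV[k]_3,
    [/\ distinct_points p, condition_I p & associated p tau].

(* The inclusion of k[x, y, z] in k[w, x, y, z]. *)
Definition inclusion_xyz (k : fieldType) (f : {mpoly k[3]}) : {mpoly k[4]} :=
  f \mPo [tuple 'X_(lift ord0 i) | i < 3].

Definition admissible_g (k : fieldType) (d : nat) (g : {mpoly k[4]}) : Prop :=
  mpoly_irreducible g /\
  exists A B : {mpoly k[3]},
    [/\ A \is (d - 1).-homog, B \is d.-homog, A != 0
      & g = 'X_ord0 * inclusion_xyz A + inclusion_xyz B].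

Definition T_map (k : fieldType) (g : {mpoly k[4]})
    (tau : 3.-tuple {mpoly k[3]}) : 4.-tuple {mpoly k[4]} :=
  [tuple of g :: map_tuple (@inclusion_xyz k) tau].

(* Main.v *)
Require Import Defs.
From HB Require Import structures.
From mathcomp Require Import all_boot all_order all_algebra.
From mathcomp Require Import ring zify.

(** Write g = w A + B, let s be the inverse of the plane map t = (t1 : t2 : t3),
    and let h be the polynomial with t(s) = h (x, y, z).  Solving the equation
    W h = w A(s) + B(s) for w inverts T = (g : t1 : t2 : t3):

      T^-1 = (W h - B(s) : A(s) s1 : A(s) s2 : A(s) s3).

    These coordinates have degree d^2, so the degree of T^-1 is d^2 minus the
    degree of the greatest common divisor of h, A(s) and B(s).
    [T_map_inverse] shows that T^-1 is this map, with any common factor l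
    divided out.

    For t take the de Jonquieres transformation

      t = (x a + b : x c y : x c z),   s = (b : K y : K z),   K = c x - a,

    where a = z^(d-1), and b and c are products of d and of d - 2 lines
    y = i z, the numbers i running over 1, ..., 2d-2.  Then
    h = b c K^(d-1): the curve K is contracted by s to the point
    p0 = (1 : 0 : 0) of multiplicity d - 1, and the 2d-2 lines to the simple
    base points.  If A and B have multiplicity at least j at p0, then K^j
    divides A(s) and B(s), and so does each line of b c contracted to a base
    point common to A and B.  The d base points coming from b lie on the line
    x = 0, and two families prescribe the pair (j, r), with r the number of
    common base points:

    - for j <= d - 2 and r <= d, A = x^(d-1-j) z^j and B = y^(d-r) times r lines
      of b; the degree of T^-1 is d^2 - (d-1) j - r ([cremona_low_vertex]);
    - for j = d - 1 and r <= d - 1, A = z^(d-1-r) times r lines of b, and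
      B = x y^(d-1); the degree of T^-1 is 2d - 1 - r ([cremona_high_vertex]).

    The second family is part (a).  For part (b), every number
    l^2 + m <= (d-1)(d-2) + d has the form (d-1) j + r with j <= d - 2 and
    r <= d, so the first family suffices.

    Coprimality is checked without unique factorization.  Each potential common
    factor q divides a product of linear forms; a linear form is prime, and it
    does not divide q if q is nonzero at some point where the form vanishes
    ([coprime_to_subst_var]).  So each such check amounts to evaluating
    polynomials at explicit points.  The irreducibility of g and of x a + b
    follows, since both are linear in a variable, with coprime coefficients
    ([mpoly_irreducible_linear]). *)

Set Implicit Arguments.
Unset Strict Implicit.
Unset Printing Implicit Defensive.

Import GRing.Theory.
Local Open Scope ring_scope.

(** * Substitution in polynomials *)

Lemma mpoly_morph_eq (R S : comNzRingType) (n : nat)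
    (f g : {rmorphism {mpoly R[n]} -> S}) :
  (forall c, f c%:MP = g c%:MP) -> (forall i, f 'X_i = g 'X_i) -> f =1 g.
Proof.
move=> fgC fgX p; rewrite [p]mpolyE !rmorph_sum; apply: eq_bigr => m _.
rewrite -mul_mpolyC !rmorphM fgC; congr (_ * _).
rewrite mpolyXE_id !rmorph_prod; apply: eq_bigr => i _.
by rewrite !rmorphXn fgX.
Qed.

Lemma comp_mpolyXE (R : comNzRingType) (n m : nat) (F : n.-tuple {mpoly R[m]}) i :
  'X_i \mPo F = tnth F i.
Proof. by rewrite comp_mpolyXU (tnth_nth 0). Qed.

Lemma comp_mpolyA (R : comNzRingType) (n m l : nat) (p : {mpoly R[n]})
    (F : n.-tuple {mpoly R[m]}) (G : m.-tuple {mpoly R[l]}) :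
  (p \mPo F) \mPo G = p \mPo [tuple tnth F i \mPo G | i < n].
Proof.
apply: (mpoly_morph_eq (f := comp_mpoly G \o comp_mpoly F)) => [c|i] /=.
  by rewrite !comp_mpolyC.
by rewrite !comp_mpolyXE tnth_mktuple.
Qed.

Lemma eq_comp_mpoly (R : comNzRingType) (n m : nat) (p : {mpoly R[n]})
    (F G : n.-tuple {mpoly R[m]}) :
  tnth F =1 tnth G -> p \mPo F = p \mPo G.
Proof. by move/eq_from_tnth->. Qed.

Lemma mmap_dhomog_scale (R S : comNzRingType) (n d : nat)
    (f : {rmorphism R -> S}) (c : S) (u v : 'I_n -> S) (p : {mpoly R[n]}) :
  p \is d.-homog -> (forall i, v i = c * u i) ->
  mmap f v p = c ^+ d * mmap f u p.
Proof.
move=> /dhomogP hp uv; rewrite /mmap big_distrr /= big_seq [RHS]big_seq.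
apply: eq_bigr => m /hp /= <-; rewrite mulrCA; congr (_ * _).
rewrite /mmap1 mdegE -prodrXr -big_split /=.
by apply: eq_bigr => i _; rewrite uv exprMn.
Qed.

Lemma comp_mpoly_scale (R : comNzRingType) (n m d : nat) (p : {mpoly R[n]})
    (c : {mpoly R[m]}) (F G : n.-tuple {mpoly R[m]}) :
  p \is d.-homog -> (forall i, tnth F i = c * tnth G i) ->
  p \mPo F = c ^+ d * (p \mPo G).
Proof. exact: mmap_dhomog_scale. Qed.

Lemma dhomog_bigprod (R : comNzRingType) (n : nat) (I : Type) (s : seq I)
    (P : pred I) (e : I -> nat) (F : I -> {mpoly R[n]}) :
  (forall i, F i \is (e i).-homog) ->
  \prod_(i <- s | P i) F i \is (\sum_(i <- s | P i) e i).-homog.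
Proof.
move=> hF; elim/big_rec2: _ => [|i p q _ hq]; first exact: dhomog1.
exact: dhomogM.
Qed.

Lemma dhomog_comp (R : comNzRingType) (n m d e : nat) (p : {mpoly R[n]})
    (F : n.-tuple {mpoly R[m]}) :
  p \is d.-homog -> (forall i, tnth F i \is e.-homog) ->
  p \mPo F \is (e * d).-homog.
Proof.
move=> /dhomogP hp hF; rewrite comp_mpolyE big_seq rpred_sum // => mm /hp /= <-.
apply: dhomogZ; rewrite mdegE big_distrr /=; apply: dhomog_bigprod => i.
exact: dhomogMn.
Qed.

Lemma dhomog_cast (k : fieldType) m (p : {mpoly k[m]}) (d e : nat) :
  p \is d.-homog -> d = e -> p \is e.-homog.
Proof. by move=> hp <-. Qed.

Lemma dhomogXU (k : fieldType) (n : nat) (i : 'I_n) :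
  ('X_i : {mpoly k[n]}) \is 1.-homog.
Proof. by rewrite dhomogX /= mdeg1. Qed.

Lemma mpolyX_neq0 (k : fieldType) (n : nat) (i : 'I_n) :
  ('X_i : {mpoly k[n]}) != 0.
Proof. by rewrite -msize_poly_eq0 msizeX mdeg1. Qed.

Lemma dhomog_coef_lt (k : fieldType) m e r (p : {mpoly k[m]}) l :
  p \is e.-homog -> (r <= e)%N -> (mdeg l < r)%N -> p@_l = 0.
Proof.
move=> hp re lr; apply: (dhomog_nemf_coeff hp); apply/eqP => /= le.
by move: (leq_trans lr re); rewrite le ltnn.
Qed.

(** * Coprimality with products of linear forms *)

(** Coprimality in the form of Euclid's lemma: it passes to products in the
    second argument, and needs no greatest common divisors. *)
Definition coprime_to (k : fieldType) (n : nat) (q p : {mpoly k[n]}) : Prop :=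
  forall u, mpoly_divides q (p * u) -> mpoly_divides q u.

Lemma coprime_toM (k : fieldType) (n : nat) (q p1 p2 : {mpoly k[n]}) :
  coprime_to q p1 -> coprime_to q p2 -> coprime_to q (p1 * p2).
Proof. by move=> h1 h2 u; rewrite -mulrA => /h1/h2. Qed.

Lemma coprime_to1 (k : fieldType) (n : nat) (q : {mpoly k[n]}) :
  coprime_to q 1.
Proof. by move=> u; rewrite mul1r. Qed.

Lemma coprime_toX (k : fieldType) (n : nat) (q p : {mpoly k[n]}) (m : nat) :
  coprime_to q p -> coprime_to q (p ^+ m).
Proof.
move=> qp; elim: m => [|m IH]; first exact: coprime_to1.
by rewrite exprS; apply: coprime_toM.
Qed.

Lemma unit_of_coprime_divides (k : fieldType) (n : nat) (q p : {mpoly k[n]}) :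
  coprime_to q p -> mpoly_divides q p -> q \is a GRing.unit.
Proof.
move=> qp; rewrite -[p]mulr1 => /qp [r qr1].
by apply/unitrPr; exists r; rewrite -qr1.
Qed.

Lemma mpoly_divides_meval (k : fieldType) (n : nat) (q p : {mpoly k[n]}) v :
  mpoly_divides q p -> p.@[v] != 0 -> q.@[v] != 0.
Proof. by case=> r ->; rewrite rmorphM mulf_eq0 => /norP[]. Qed.

Definition subst_var (k : fieldType) (n : nat) (i : 'I_n) (g : {mpoly k[n]}) :
    n.-tuple {mpoly k[n]} := [tuple if j == i then g else 'X_j | j < n].

(** The factor theorem in the variable X_i. *)
Lemma subst_var_divides (k : fieldType) (n : nat) (i : 'I_n)
    (g p : {mpoly k[n]}) :
  mpoly_divides ('X_i - g) (p - (p \mPo subst_var i g)).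
Proof.
elim/mpolyind: p => [|c m p _ _ [r hr]].
  by exists 0; rewrite comp_mpoly0 subrr mulr0.
suff [r' hr']: mpoly_divides ('X_i - g) ('X_[m] - ('X_[m] \mPo subst_var i g)).
  by exists (c *: r' + r); rewrite mulrDr -scalerAr -hr -hr' comp_mpolyD
    comp_mpolyZ scalerBr opprD addrACA.
rewrite (mpolyXE_id _ m) rmorph_prod /=.
elim/big_rec2: _ => [|j a b _ [r' hr']]; first by exists 0; rewrite subrr mulr0.
rewrite rmorphXn /= comp_mpolyXE tnth_mktuple.
have -> : forall x y z t : {mpoly k[n]}, x * y - z * t = x * (y - t) + (x - z) * t.
  by move=> *; ring.
rewrite hr'; case: eqP => [->|_].
  by rewrite subrXX mulrCA -mulrA -mulrDr; eexists; reflexivity.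
by exists ('X_j ^+ m j * r'); rewrite subrr !mul0r addr0 mulrCA.
Qed.

(** X_i - g generates the kernel of the substitution of g for X_i, whose target is
    a domain, so it is prime; a zero of X_i - g at which q is nonzero shows that
    it does not divide q. *)
Lemma coprime_to_subst_var (k : fieldType) (n : nat) (i : 'I_n)
    (g q : {mpoly k[n]}) :
  'X_i - g != 0 -> g \mPo subst_var i g = g ->
  (exists2 v : 'I_n -> k, v i = g.@[v] & q.@[v] != 0) ->
  coprime_to q ('X_i - g).
Proof.
move=> L_neq0 gfix [v vi qv] u [r hr].
have Lv : ('X_i - g).@[v] = 0 by rewrite mevalB mevalXU vi subrr.
have L0 : ('X_i - g) \mPo subst_var i g = 0.
  by rewrite comp_mpolyB comp_mpolyXE tnth_mktuple eqxx gfix subrr.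
have : (q * r) \mPo subst_var i g = 0 by rewrite -hr rmorphM /= L0 mul0r.
rewrite rmorphM /= => /eqP; rewrite mulf_eq0 => /orP[/eqP q0|/eqP r0].
  have [q' hq] := subst_var_divides i g q; move: qv.
  by rewrite -[q]subr0 -q0 hq mevalM Lv mul0r eqxx.
have [r' hr'] := subst_var_divides i g r.
rewrite r0 subr0 in hr'; exists r'; apply: (mulfI L_neq0).
by rewrite hr hr'; ring.
Qed.

Lemma coprime_to_var (k : fieldType) (n : nat) (i : 'I_n) (q : {mpoly k[n]}) :
  (exists2 v : 'I_n -> k, v i = 0 & q.@[v] != 0) -> coprime_to q 'X_i.
Proof.
move=> hv; rewrite -['X_i]subr0; apply: coprime_to_subst_var.
- by rewrite subr0 -msize_poly_eq0 msizeX mdeg1.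
- by rewrite comp_mpoly0.
by case: hv => v vi qv; exists v => //; rewrite meval0.
Qed.

Lemma coprime_to_line (k : fieldType) (n : nat) (i j : 'I_n) (c : nat)
    (q : {mpoly k[n]}) :
  i != j -> (exists2 v : 'I_n -> k, v i = c%:R * v j & q.@[v] != 0) ->
  coprime_to q ('X_i - c%:R * 'X_j).
Proof.
move=> ij hv; apply: coprime_to_subst_var.
- apply/eqP => /(congr1 (meval (fun l => (l == i)%:R))).
  rewrite meval0 mevalB mevalM !mevalXU eqxx eq_sym (negbTE ij) mulr0 subr0.
  by apply/eqP; rewrite oner_eq0.
- by rewrite rmorphM /= rmorph_nat comp_mpolyXE tnth_mktuple eq_sym (negbTE ij).
by case: hv => v vi qv; exists v => //; rewrite mevalM mevalXU rmorph_nat.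
Qed.

(** * Irreducibility of polynomials that are linear in one variable *)

(** The coefficients stay in the ring of all the variables, so that evaluation at
    X_i is a left inverse. *)
Definition poly_in (k : fieldType) (n : nat) (i : 'I_n) :
    {mpoly k[n]} -> {poly {mpoly k[n]}} :=
  mmap (polyC \o @mpolyC n k) (fun j => if j == i then 'X else ('X_j)%:P).
HB.instance Definition _ (k : fieldType) (n : nat) (i : 'I_n) :=
  GRing.RMorphism.copy (@poly_in k n i)
    (mmap (polyC \o @mpolyC n k) (fun j => if j == i then 'X else ('X_j)%:P)).

Lemma poly_inX (k : fieldType) (n : nat) (i j : 'I_n) :
  poly_in i ('X_j : {mpoly k[n]}) = if j == i then 'X else ('X_j)%:P.
Proof. by rewrite /poly_in mmapX mmap1U. Qed.

Lemma poly_inK (k : fieldType) (n : nat) (i : 'I_n) :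
  cancel (@poly_in k n i) (horner_eval 'X_i).
Proof.
move=> p; apply: (mpoly_morph_eq (f := horner_eval 'X_i \o poly_in i)
  (g := idfun)) => [c|j] /=; rewrite /horner_eval.
  by rewrite /poly_in mmapC /= hornerC.
by rewrite poly_inX; case: eqP => [->|_]; rewrite ?hornerX ?hornerC.
Qed.

(** By degrees in X_i, one factor is free of X_i; it then divides both A and B. *)
Lemma mpoly_irreducible_linear (k : fieldType) (n : nat) (i : 'I_n)
    (A B : {mpoly k[n]}) :
  poly_in i A = A%:P -> poly_in i B = B%:P -> A != 0 ->
  (forall q, mpoly_divides q A -> mpoly_divides q B -> q \is a GRing.unit) ->
  mpoly_irreducible ('X_i * A + B).
Proof.
move=> hA hB A0 AB; move gE: ('X_i * A + B) => g.
have hg : poly_in i g = A *: 'X + B%:P.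
  by rewrite -gE rmorphD rmorphM /= hA hB poly_inX eqxx mulrC mul_polyC.
have sg : size (poly_in i g) = 2.
  by rewrite hg -mul_polyC size_MXaddC polyC_eq0 (negbTE A0) size_polyC A0.
have main (q r : {mpoly k[n]}) : g = q * r ->
    (size (poly_in i r) <= 1)%N -> r \is a GRing.unit.
  move=> gqr /size1_polyC hr; set r0 := (poly_in i r)`_0 in hr.
  have rr0 : r = r0 by rewrite -[LHS](poly_inK i) hr /horner_eval hornerC.
  rewrite -rr0 in hr.
  have e : A *: 'X + B%:P = poly_in i q * r%:P by rewrite -hg gqr rmorphM /= hr.
  apply: AB.
    exists (poly_in i q)`_1; rewrite mulrC -coefMC -e.
    by rewrite coefD coefZ coefX coefC mulr1 addr0.
  exists (poly_in i q)`_0; rewrite mulrC -coefMC -e.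
  by rewrite coefD coefZ coefX coefC mulr0 add0r.
have g0 : g != 0.
  by apply/eqP => g0; move: sg; rewrite g0 rmorph0 size_poly0.
have nz (p : {mpoly k[n]}) : p != 0 -> poly_in i p != 0.
  by apply: contra => /eqP p0; rewrite -[p](poly_inK i) p0 /horner_eval horner0.
have sz (q r : {mpoly k[n]}) : q != 0 -> r != 0 ->
    size (poly_in i (q * r)) = (size (poly_in i q) + size (poly_in i r)).-1.
  move=> q0 r0; rewrite rmorphM /= size_proper_mul //.
  by rewrite mulf_neq0 // lead_coef_eq0 nz.
split=> // [|q r gqr].
  apply/negP => /unitrPr[q gq1].
  have q0 : q != 0.
    by apply: contra_eq_neq gq1 => ->; rewrite mulr0 eq_sym oner_eq0.
  have := sz g q g0 q0; rewrite gq1 [X in (X + _)%N]sg.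
  have -> : poly_in i (1 : {mpoly k[n]}) = 1 by exact: rmorph1.
  rewrite size_poly1 => /esym/eqP.
  by rewrite eqSS size_poly_eq0; apply/negP/nz.
have [q0 r0] : q != 0 /\ r != 0.
  by apply/andP; move: g0; rewrite gqr mulf_eq0 negb_or.
have := sz q r q0 r0; rewrite -gqr [X in X = _]sg.
case: (leqP (size (poly_in i r)) 1) => [hr _|hr e].
  by right; apply: main gqr hr.
by left; apply: (main r q); rewrite 1?mulrC //; move: hr e; lia.
Qed.

(** * Rational maps and their inverses *)

Lemma homogeneous_comp (k : fieldType) (n m l d e : nat)
    (F : n.-tuple {mpoly k[m]}) (G : m.-tuple {mpoly k[l]}) :
  homogeneous_tuple d F -> homogeneous_tuple e G ->
  homogeneous_tuple (e * d) [tuple tnth F i \mPo G | i < n].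
Proof. by move=> hF hG i; rewrite tnth_mktuple; apply: dhomog_comp. Qed.

Lemma same_ratmap_refl (k : fieldType) (n : nat)
    (F : n.+1.-tuple {mpoly k[n.+1]}) :
  is_ratmap F -> same_ratmap F F.
Proof. by move=> hF; split=> // i j; rewrite mulrC. Qed.

(** The factor c is there for maps whose composite is computed only after clearing
    a common factor of the coordinates. *)
Lemma same_ratmap_id (k : fieldType) (n D : nat)
    (F : n.+1.-tuple {mpoly k[n.+1]}) (c u : {mpoly k[n.+1]}) :
  homogeneous_tuple D F -> u != 0 -> (forall i, c * tnth F i = u * 'X_i) ->
  same_ratmap F (id_ratmap k n).
Proof.
move=> hF u0 cF.
have uX i : u * 'X_i != 0 by rewrite mulf_neq0 ?mpolyX_neq0.
have c0 : c != 0 by apply: contraNneq (uX ord0) => c0; rewrite -cF c0 mul0r.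
split.
- split; first by exists D.
  by exists ord0; apply: contraNneq (uX ord0) => F0; rewrite -cF F0 mulr0.
- split; first by exists 1%N => i; rewrite tnth_mktuple dhomogXU.
  by exists ord0; rewrite tnth_mktuple mpolyX_neq0.
move=> i j; rewrite !tnth_mktuple; apply: (mulfI c0).
by rewrite !mulrA !cF; ring.
Qed.

Lemma inclusion_comp (k : fieldType) (m : nat) (f : {mpoly k[3]})
    (F : 4.-tuple {mpoly k[m]}) :
  inclusion_xyz f \mPo F = f \mPo [tuple tnth F (lift ord0 i) | i < 3].
Proof.
rewrite comp_mpolyA; apply: eq_comp_mpoly => i.
by rewrite !tnth_mktuple comp_mpolyXE.
Qed.

HB.instance Definition _ (k : fieldType) :=
  GRing.RMorphism.copy (@inclusion_xyz k)
    (comp_mpoly [tuple 'X_(lift ord0 i) | i < 3]).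

Lemma inclusion_inj (k : fieldType) : injective (@inclusion_xyz k).
Proof.
apply: (can_inj (g := comp_mpoly [tuple of 0 :: [tuple 'X_i | i < 3]])) => f.
rewrite inclusion_comp -[RHS]comp_mpoly_id; apply: eq_comp_mpoly => i.
by rewrite tnth_mktuple tnthS.
Qed.

Lemma inclusionX (k : fieldType) (i : 'I_3) :
  inclusion_xyz ('X_i : {mpoly k[3]}) = 'X_(lift ord0 i).
Proof. by rewrite /inclusion_xyz comp_mpolyXE tnth_mktuple. Qed.

Lemma dhomog_inclusion (k : fieldType) (d : nat) (f : {mpoly k[3]}) :
  f \is d.-homog -> inclusion_xyz f \is d.-homog.
Proof.
move=> hf; rewrite -[d]mul1n; apply: dhomog_comp => // i.
by rewrite tnth_mktuple dhomogXU.
Qed.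

Lemma dhomog_linear_w (k : fieldType) (d : nat) (A : {mpoly k[3]})
    (C : {mpoly k[4]}) :
  A \is d.-homog -> C \is d.+1.-homog ->
  'X_ord0 * inclusion_xyz A + C \is d.+1.-homog.
Proof.
move=> hA hC; rewrite rpredD //.
by apply: (@dhomogM _ _ _ 1); [exact: dhomogXU|exact: dhomog_inclusion].
Qed.

Lemma comp_inclusion (k : fieldType) (f : {mpoly k[3]})
    (F : 3.-tuple {mpoly k[3]}) :
  f \mPo [tuple inclusion_xyz (tnth F i) | i < 3] = inclusion_xyz (f \mPo F).
Proof. by rewrite [RHS]comp_mpolyA. Qed.

Lemma comp_T_map (k : fieldType) (f : {mpoly k[3]}) (g : {mpoly k[4]})
    (F : 3.-tuple {mpoly k[3]}) :
  inclusion_xyz f \mPo T_map g F = inclusion_xyz (f \mPo F).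
Proof.
rewrite inclusion_comp -comp_inclusion; apply: eq_comp_mpoly => i.
by rewrite !tnth_mktuple tnthS tnth_map.
Qed.

Lemma cremona_of_scalars (k : fieldType) (n d e : nat)
    (F G : n.+1.-tuple {mpoly k[n.+1]}) (h u : {mpoly k[n.+1]}) :
  homogeneous_tuple d F -> homogeneous_tuple e G -> h != 0 -> u != 0 ->
  (forall i, tnth F i \mPo G = h * 'X_i) ->
  (forall i, tnth G i \mPo F = u * 'X_i) ->
  cremona F.
Proof.
move=> hF hG h0 u0 FG GF.
have nz (P Q : n.+1.-tuple {mpoly k[n.+1]}) (c : {mpoly k[n.+1]}) :
    c != 0 -> (forall i, tnth P i \mPo Q = c * 'X_i) -> tnth P ord0 != 0.
  move=> c0 /(_ ord0) e0; apply: contraNneq (mulf_neq0 c0 (mpolyX_neq0 k ord0)).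
  by move=> P0; rewrite -e0 P0 comp_mpoly0.
exists G; split.
- by split; [exists d|exists ord0; apply: nz h0 FG].
- by split; [exists e|exists ord0; apply: nz u0 GF].
- apply: (@same_ratmap_id _ _ _ _ 1 u _ u0); first exact: homogeneous_comp hG hF.
  by move=> i; rewrite tnth_mktuple mul1r GF.
apply: (@same_ratmap_id _ _ _ _ 1 h _ h0); first exact: homogeneous_comp hF hG.
by move=> i; rewrite tnth_mktuple mul1r FG.
Qed.

(** Meant for h, A, B equal to h, A(s), B(s) up to a common factor. *)
Definition T_inverse (k : fieldType) (h A B : {mpoly k[3]})
    (s : 3.-tuple {mpoly k[3]}) : 4.-tuple {mpoly k[4]} :=
  T_map ('X_ord0 * inclusion_xyz h - inclusion_xyz B)
    [tuple A * tnth s i | i < 3].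

Lemma T_map_homog (k : fieldType) (d : nat) (g : {mpoly k[4]})
    (F : 3.-tuple {mpoly k[3]}) :
  g \is d.-homog -> homogeneous_tuple d F -> homogeneous_tuple d (T_map g F).
Proof.
move=> hg hF i; case: (unliftP ord0 i) => [j|] ->; last by rewrite tnth0.
by rewrite tnthS tnth_map dhomog_inclusion.
Qed.

Lemma T_inverse_homog (k : fieldType) (e : nat) (h A B : {mpoly k[3]})
    (s : 3.-tuple {mpoly k[3]}) :
  h \is e.-homog -> B \is e.+1.-homog ->
  (forall i, A * tnth s i \is e.+1.-homog) ->
  homogeneous_tuple e.+1 (T_inverse h A B s).
Proof.
move=> hh hB hA; apply: T_map_homog => [|i]; last by rewrite tnth_mktuple.
by apply: dhomog_linear_w; rewrite // dhomogN dhomog_inclusion.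
Qed.

(** After multiplication by l, the candidate inverse becomes
    (W h - B(s) : A(s) s1 : A(s) s2 : A(s) s3), and by homogeneity both composites
    are explicit multiples of the identity, by A(s)^(D+1) h and by u^(D+1) A. *)
Lemma T_map_inverse (k : fieldType) (D e : nat)
    (tau s : 3.-tuple {mpoly k[3]}) (A B h u l A' B' h' : {mpoly k[3]}) :
  homogeneous_tuple D.+1 tau ->
  A \is D.-homog -> B \is D.+1.-homog -> A != 0 -> h != 0 -> u != 0 ->
  (forall i, tnth tau i \mPo s = h * 'X_i) ->
  (forall i, tnth s i \mPo tau = u * 'X_i) ->
  A \mPo s = l * A' -> B \mPo s = l * B' -> h = l * h' ->
  homogeneous_tuple e.+1 (T_inverse h' A' B' s) ->
  inverse_ratmaps (T_map ('X_ord0 * inclusion_xyz A + inclusion_xyz B) tau)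
    (T_inverse h' A' B' s).
Proof.
move=> htau hA hB A0 h0 u0 taus stau eA eB eh hG.
set g := _ + _; set T := T_map g tau; set G := T_inverse _ _ _ _.
have inc0 (f : {mpoly k[3]}) : f != 0 -> inclusion_xyz f != 0.
  by apply: contra_neq => f0; apply: inclusion_inj; rewrite f0 rmorph0.
have hT : homogeneous_tuple D.+1 T.
  by apply: T_map_homog; rewrite // dhomog_linear_w ?dhomog_inclusion.
have scale_tau (f : {mpoly k[3]}) m : f \is m.-homog ->
    (f \mPo s) \mPo tau = u ^+ m * f.
  move=> hf; rewrite comp_mpolyA -[f in RHS]comp_mpoly_id.
  by apply: comp_mpoly_scale => // i; rewrite !tnth_mktuple stau.
have As0 : A \mPo s != 0.
  have : (A \mPo s) \mPo tau != 0.
    by rewrite (scale_tau _ _ hA) mulf_neq0 ?expf_neq0.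
  by apply: contra_neq => ->; rewrite comp_mpoly0.
have tau0 i : tnth tau i != 0.
  apply: contraNneq (mulf_neq0 h0 (mpolyX_neq0 k i)) => t0.
  by rewrite -taus t0 comp_mpoly0.
have htauE : h \mPo tau = u ^+ D.+1.
  apply: (mulIf (tau0 ord0)); rewrite -(scale_tau _ _ (htau ord0)) taus.
  by rewrite rmorphM /= comp_mpolyXE.
set L := inclusion_xyz l; set H := inclusion_xyz h.
set a := inclusion_xyz (A \mPo s); set b := inclusion_xyz (B \mPo s).
have LG0 : L * tnth G ord0 = 'X_ord0 * H - b.
  by rewrite /G /T_inverse tnth0 mulrBr mulrCA -!rmorphM -eh -eB.
have LGS i : L * tnth G (lift ord0 i) = a * inclusion_xyz (tnth s i).
  rewrite /G /T_inverse tnthS tnth_map tnth_mktuple.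
  by rewrite -!rmorphM mulrA -eA.
have LGf (f : {mpoly k[3]}) m : f \is m.-homog ->
    L ^+ m * (inclusion_xyz f \mPo G) = a ^+ m * inclusion_xyz (f \mPo s).
  move=> hf; rewrite inclusion_comp -comp_inclusion.
  rewrite -(comp_mpoly_scale (c := L) (F := [tuple L * tnth G (lift ord0 i) | i < 3]) hf).
    by apply: comp_mpoly_scale => // i; rewrite !tnth_mktuple LGS.
  by move=> i; rewrite !tnth_mktuple.
have LGg : L ^+ D.+1 * (g \mPo G) = a ^+ D.+1 * H * 'X_ord0.
  rewrite comp_mpolyD mulrDr (LGf _ _ hB) rmorphM /= comp_mpolyXE.
  rewrite exprSr -mulrA [L * _]mulrA LG0 mulrCA (LGf _ _ hA) -/a -/b.
  by rewrite [a ^+ D.+1]exprSr; ring.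
have nz : a ^+ D.+1 * H != 0 by rewrite mulf_neq0 ?expf_neq0 // inc0.
have nz' : inclusion_xyz (u ^+ D.+1 * A) != 0.
  by rewrite inc0 // mulf_neq0 ?expf_neq0.
have TG i : L ^+ D.+1 * (tnth T i \mPo G) = a ^+ D.+1 * H * 'X_i.
  case: (unliftP ord0 i) => [j|] ->; last by rewrite tnth0.
  rewrite tnthS tnth_map (LGf _ _ (htau j)) taus rmorphM /= -/H mulrA.
  by rewrite inclusionX.
have TAs : (l \mPo tau) * (A' \mPo tau) = u ^+ D * A.
  by rewrite -(scale_tau _ _ hA) eA rmorphM.
have GT i : inclusion_xyz (l \mPo tau) * (tnth G i \mPo T) =
    inclusion_xyz (u ^+ D.+1 * A) * 'X_i.
  case: (unliftP ord0 i) => [j|] ->.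
    rewrite /G /T_inverse tnthS tnth_map tnth_mktuple comp_T_map -inclusionX.
    rewrite -!rmorphM; congr inclusion_xyz.
    by rewrite !rmorphM /= mulrA TAs stau exprS; ring.
  rewrite /G /T_inverse tnth0 comp_mpolyB rmorphM /= comp_mpolyXE !comp_T_map.
  rewrite tnth0 mulrBr mulrCA -!rmorphM /= -eh htauE -eB (scale_tau _ _ hB).
  by rewrite /g exprS !rmorphM /=; ring.
split.
- split; first by exists D.+1.
  exists ord0; apply: contraNneq (mulf_neq0 nz (mpolyX_neq0 k ord0)) => T0.
  by rewrite -TG T0 comp_mpoly0 mulr0.
- split; first by exists e.+1.
  exists ord0; apply: contraNneq (mulf_neq0 nz' (mpolyX_neq0 k ord0)) => G0.
  by rewrite -GT G0 comp_mpoly0 mulr0.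
- apply: (same_ratmap_id (c := inclusion_xyz (l \mPo tau))
    (homogeneous_comp hG hT) nz') => i.
  by rewrite tnth_mktuple GT.
apply: (same_ratmap_id (c := L ^+ D.+1) (homogeneous_comp hT hG) nz) => i.
by rewrite tnth_mktuple TG.
Qed.

(** * Multiplicities *)

Lemma chart_atP (k : fieldType) (n : nat) (p : 'rV[k]_n.+1) :
  p != 0 -> p 0 (chart_at p) != 0.
Proof.
move=> p0; rewrite /chart_at; case: pickP => //= pz.
by case/eqP: p0; apply/rowP => i; rewrite mxE; apply/eqP/negPn; rewrite pz.
Qed.

Lemma lowest_degree_ge (k : fieldType) (n r : nat) (f : {mpoly k[n]}) :
  f != 0 -> (forall m, (mdeg m < r)%N -> f@_m = 0) -> (r <= lowest_degree f)%N.
Proof.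
move=> f0 hf.
have supp m : m \in msupp f -> (r <= mdeg m)%N.
  by rewrite mcoeff_msupp leqNgt; apply: contra => /hf ->.
rewrite /lowest_degree big_seq; elim/big_ind: _ => [|a b ha hb|//].
  by rewrite (leq_trans (supp _ (mlead_supp f0))) // -mlead_deg.
by rewrite leq_min ha.
Qed.

Lemma lowest_degree_le (k : fieldType) (n : nat) (f : {mpoly k[n]}) m :
  m \in msupp f -> (lowest_degree f <= mdeg m)%N.
Proof.
rewrite /lowest_degree; elim: (msupp f) => // a s IH; rewrite big_cons inE.
by case/orP => [/eqP ->|/IH h]; rewrite geq_min ?leqnn // h orbT.
Qed.

(** The point c v lies in the chart X_i = p_i in which the local equation lives. *)
Lemma mmap_local_equation (k K : fieldType) (f : {rmorphism k -> K}) (n d : nat)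
    (F : {mpoly k[n.+1]}) (p : 'rV[k]_n.+1) (v : 'I_n.+1 -> K) :
  F \is d.-homog -> v (chart_at p) != 0 ->
  let c := f (p 0 (chart_at p)) / v (chart_at p) in
  mmap f (fun j => c * v j - f (p 0 j)) (local_equation F p) =
    c ^+ d * mmap f v F.
Proof.
move=> hF vi c; rewrite -(mmap_dhomog_scale f (v := fun j => c * v j) hF) //.
apply: (mpoly_morph_eq (f := mmap f _ \o comp_mpoly _) (g := mmap f _)) => [a|j] /=.
  by rewrite comp_mpolyC !mmapC.
rewrite comp_mpolyXE tnth_mktuple mmapX mmap1U mmapD mmapC.
have [->|_] := eqVneq j (chart_at p).
  by rewrite mmap0 addr0 /c (divfK vi).
by rewrite mmapX mmap1U addrC subrK.
Qed.

(** The previous identity at the generic point, whose coordinates are the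
    variables in the fraction field: if the local equation were zero, F would vanish
    there, so it would be zero. *)
Lemma local_equation_neq0 (k : fieldType) (n d : nat) (F : {mpoly k[n.+1]})
    (p : 'rV[k]_n.+1) :
  F \is d.-homog -> F != 0 -> p != 0 -> local_equation F p != 0.
Proof.
move=> hF F0 /chart_atP pi0.
pose f : {rmorphism k -> {fraction {mpoly k[n.+1]}}} :=
  (@tofrac {mpoly k[n.+1]}) \o @mpolyC n.+1 k.
pose v j := tofrac ('X_j : {mpoly k[n.+1]}).
have v0 : v (chart_at p) != 0 by rewrite tofrac_eq0 mpolyX_neq0.
have := mmap_local_equation f hF v0.
have -> : mmap f v F = tofrac F.
  apply: (mpoly_morph_eq (f := mmap f v) (g := @tofrac _)) => [c|j].
    exact: mmapC.
  by rewrite [LHS]mmapX mmap1U.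
move=> /= e; apply: contraNneq F0 => L0; move: e; rewrite L0 [LHS]mmap0.
move/esym/eqP; rewrite mulf_eq0 tofrac_eq0 expf_eq0 => /orP[/andP[_]|//].
by rewrite mulf_eq0 invr_eq0 (negbTE v0) tofrac_eq0 mpolyC_eq0 (negbTE pi0).
Qed.

Lemma mult_ge (k : fieldType) (n d r : nat) (F : {mpoly k[n.+1]})
    (p : 'rV[k]_n.+1) :
  F \is d.-homog -> F != 0 -> p != 0 ->
  (forall m, (mdeg m < r)%N -> (local_equation F p)@_m = 0) ->
  (r <= mult F p)%N.
Proof.
by move=> hF F0 p0; apply: lowest_degree_ge; apply: local_equation_neq0 hF F0 p0.
Qed.

Lemma local_equation_coef0 (k : fieldType) (n : nat) (F : {mpoly k[n.+1]})
    (p : 'rV[k]_n.+1) m :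
  F.@[p 0] = 0 -> (mdeg m < 1)%N -> (local_equation F p)@_m = 0.
Proof.
move=> Fp; rewrite ltnS leqn0 mdeg_eq0 => /eqP ->.
rewrite -{}Fp; apply: (mpoly_morph_eq (f := mcoeff 0%MM \o comp_mpoly _)
  (g := meval _)) => [c|j] /=.
  by rewrite comp_mpolyC mevalC mcoeffC eqxx mulr1.
rewrite comp_mpolyXE tnth_mktuple mevalXU mcoeffD mcoeffC eqxx mulr1.
by case: eqP => _; rewrite ?mcoeff0 ?mcoeffX ?mnm1_eq0 addr0.
Qed.

(** On the line p + X v, which stays in the chart, the terms of degree r in the
    local equation restrict to multiples of X^r. *)
Lemma mult_le (k : fieldType) (n r : nat) (F : {mpoly k[n.+1]})
    (p : 'rV[k]_n.+1) (v : 'I_n.+1 -> k) :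
  v (chart_at p) = 0 ->
  (mmap (@polyC k) (fun j => (p 0 j)%:P + v j *: 'X) F)`_r != 0 ->
  (mult F p <= r)%N.
Proof.
move=> vi.
have -> : mmap (@polyC k) (fun j => (p 0 j)%:P + v j *: 'X) F =
    mmap (@polyC k) (fun j => v j *: 'X) (local_equation F p).
  apply/esym.
  apply: (mpoly_morph_eq (f := mmap (@polyC k) _ \o comp_mpoly _)
    (g := mmap (@polyC k) _)) => [c|j] /=.
    by rewrite comp_mpolyC !mmapC.
  rewrite comp_mpolyXE tnth_mktuple !mmapX !mmap1U mmapD mmapC.
  case: eqP => [->|_]; first by rewrite mmap0 vi scale0r.
  by rewrite mmapX mmap1U.
rewrite /mult; move: (local_equation F p) => f; rewrite /mmap coef_sum => fr.
have [m mf mr] : exists2 m, m \in msupp f & mdeg m = r.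
  have [/hasP[m mf /eqP mr]|/hasPn none] :=
    boolP (has (fun m => mdeg m == r) (msupp f)); first by exists m.
  case/eqP: fr.
  rewrite big_seq big1 // => m /none /eqP mr.
  rewrite coefCM /mmap1 (eq_bigr (fun i => (v i ^+ m i) *: 'X^(m i))); last first.
    by move=> i _; rewrite exprZn.
  rewrite scaler_prod prodrXr -mdegE coefZ coefXn eq_sym.
  by case: eqP => // _; rewrite !mulr0.
by rewrite -mr lowest_degree_le.
Qed.

(** * Products of lines of a pencil *)

(** The slopes start at 1: the lines y = 0 and z = 0 are kept out, to serve as
    factors coprime to every such product. *)
Definition pencil (R : comNzRingType) (m n : nat) (y z : R) : R :=
  \prod_(m <= i < n) (y - i.+1%:R * z).

Lemma rmorph_pencil (R S : comNzRingType) (f : {rmorphism R -> S}) m n y z :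
  f (pencil m n y z) = pencil m n (f y) (f z).
Proof.
rewrite rmorph_prod; apply: eq_bigr => i _.
by rewrite rmorphB rmorphM rmorph_nat.
Qed.

Lemma pencil_scale (R : comNzRingType) (c : R) m n y z :
  pencil m n (c * y) (c * z) = c ^+ (n - m) * pencil m n y z.
Proof.
rewrite /pencil -prodr_const_nat -big_split; apply: eq_bigr => i _ /=.
by rewrite mulrBr mulrCA.
Qed.

Lemma coprime_to_pencil (k : fieldType) (n : nat) (y z : 'I_n) (a b : nat)
    (q : {mpoly k[n]}) :
  y != z ->
  (forall i, (a <= i < b)%N ->
     exists2 v : 'I_n -> k, v y = i.+1%:R * v z & q.@[v] != 0) ->
  coprime_to q (pencil a b 'X_y 'X_z).
Proof.
move=> yz hv; rewrite /pencil big_nat.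
elim/big_ind: _ => [|p1 p2|i /hv]; [exact: coprime_to1|exact: coprime_toM|].
exact: coprime_to_line.
Qed.

Lemma pencil_cat (R : comNzRingType) m l r (y z : R) :
  (m <= l <= r)%N -> pencil m r y z = pencil m l y z * pencil l r y z.
Proof. by case/andP => ml lr; rewrite /pencil (big_cat_nat ml lr). Qed.

Lemma dhomog_pencil (k : fieldType) (n m r : nat) (y z : {mpoly k[n]}) :
  y \is 1.-homog -> z \is 1.-homog -> pencil m r y z \is (r - m).-homog.
Proof.
move=> hy hz; rewrite -[(r - m)%N]muln1 -sum_nat_const_nat.
apply: dhomog_bigprod => i; rewrite rpredB // mulr_natl.
by rewrite rpredMn.
Qed.

Section CharZero.
Variables (k : fieldType) (hchar : [pchar k] =i pred0).

Lemma natr_eq (i j : nat) : (i%:R == j%:R :> k) = (i == j).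
Proof.
wlog ij : i j / (i <= j)%N => [hw|].
  by case/orP: (leq_total i j) => /hw // e; rewrite eq_sym e eq_sym.
rewrite -(subnK ij) natrD -subr_eq0 opprD addrCA subrr addr0 oppr_eq0.
by rewrite ((pcharf0P k).1 hchar) -[i in RHS]add0n eqn_add2r eq_sym.
Qed.

Lemma pencil_nat_eq0 m r (i : nat) :
  (pencil m r i.+1%:R 1 == 0 :> k) = (m <= i < r)%N.
Proof.
rewrite /pencil; apply/idP/idP => [|ir].
  rewrite prodf_seq_eq0 => /hasP[j]; rewrite mem_index_iota mulr1 subr_eq0 natr_eq.
  by rewrite eqSS => ir /eqP ->.
rewrite prodf_seq_eq0; apply/hasP; exists i; first by rewrite mem_index_iota.
by rewrite mulr1 subrr eqxx.
Qed.

Lemma pencil10 m r : pencil m r 1 0 = 1 :> k.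
Proof. by rewrite /pencil big1 // => i _; rewrite mulr0 subr0. Qed.

Lemma pencil01_neq0 m r : pencil m r 0 1 != 0 :> k.
Proof.
rewrite prodf_seq_neq0; apply/allP => i _ /=.
by rewrite mulr1 sub0r oppr_eq0 ((pcharf0P k).1 hchar).
Qed.

Lemma pencil_simple_root m r j : (m <= j < r)%N ->
  (pencil m r ((j.+1%:R)%:P + 'X) 1 : {poly k})`_1 != 0.
Proof.
move=> mjr; rewrite /pencil (bigD1_seq j) ?mem_index_iota ?iota_uniq //=.
rewrite mulr1 rmorph_nat addrAC subrr add0r coefXM /=.
rewrite -horner_coef0 horner_prod prodf_seq_neq0; apply/allP => l _.
apply/implyP => lj; rewrite -[X in _ + 'X - X * _](rmorph_nat (@polyC k)) !hornerE.
by rewrite subr_eq0 -(rmorph_nat (@polyC k)) hornerC natr_eq // eqSS eq_sym.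
Qed.

End CharZero.

(** * A de Jonquieres transformation of the plane *)

Section DeJonquieres.
Variable n : nat.

(** With d = n + 2, these are b, c, the curve x a + b, the common factor x c of the
    other two coordinates of the plane map, and the curve K = c x - a contracted by
    its inverse.  Over an arbitrary ring, so that substitutions and evaluations
    act on them through their arguments. *)
Definition bform (R : comNzRingType) (y z : R) : R := pencil 0 n.+2 y z.
Definition cform (R : comNzRingType) (y z : R) : R := pencil n.+2 (n.+2 + n) y z.
Definition dj_curve (R : comNzRingType) (x y z : R) : R :=
  x * z ^+ n.+1 + bform y z.
Definition dj_factor (R : comNzRingType) (x y z : R) : R := x * cform y z.
Definition dj_cone (R : comNzRingType) (x y z : R) : R :=
  cform y z * x - z ^+ n.+1.

Section Morphism.
Variables (R S : comNzRingType) (f : {rmorphism R -> S}).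
Lemma rmorph_bform y z : f (bform y z) = bform (f y) (f z).
Proof. exact: rmorph_pencil. Qed.
Lemma rmorph_cform y z : f (cform y z) = cform (f y) (f z).
Proof. exact: rmorph_pencil. Qed.
Lemma rmorph_curve x y z : f (dj_curve x y z) = dj_curve (f x) (f y) (f z).
Proof. by rewrite rmorphD rmorphM rmorphXn rmorph_bform. Qed.
Lemma rmorph_factor x y z : f (dj_factor x y z) = dj_factor (f x) (f y) (f z).
Proof. by rewrite rmorphM rmorph_cform. Qed.
Lemma rmorph_cone x y z : f (dj_cone x y z) = dj_cone (f x) (f y) (f z).
Proof. by rewrite rmorphB rmorphM rmorphXn rmorph_cform. Qed.
End Morphism.

Definition rmorph_dj :=
  (rmorph_curve, rmorph_factor, rmorph_cone, rmorph_bform, rmorph_cform).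

Section Identities.
Variables (R : comNzRingType) (x y z : R).
Let b := bform y z.
Let c := cform y z.
Let K := dj_cone x y z.
Let f := dj_factor x y z.

Lemma bform_scale (t : R) : bform (t * y) (t * z) = t ^+ n.+2 * b.
Proof. exact: pencil_scale. Qed.

Lemma cform_scale (t : R) : cform (t * y) (t * z) = t ^+ n * c.
Proof. by rewrite /cform pencil_scale addKn. Qed.

Lemma dj_curve_inverse :
  dj_curve b (K * y) (K * z) = b * c * K ^+ n.+1 * x.
Proof.
have KE : K + z ^+ n.+1 = c * x by rewrite subrK.
rewrite /dj_curve bform_scale exprMn [K ^+ n.+2]exprSr.
transitivity (b * K ^+ n.+1 * (K + z ^+ n.+1)); first by ring.
by rewrite KE; ring.
Qed.

Lemma dj_factor_inverse : dj_factor b (K * y) (K * z) * K = b * c * K ^+ n.+1.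
Proof. by rewrite /dj_factor cform_scale exprSr; ring. Qed.

Lemma dj_bform_inverse : bform (f * y) (f * z) = f ^+ n.+1 * b * c * x.
Proof.
have fE : f = x * c by [].
by rewrite bform_scale [f ^+ n.+2]exprSr {2}fE; ring.
Qed.

Lemma dj_cone_inverse :
  dj_cone (dj_curve x y z) (f * y) (f * z) * f = f ^+ n.+1 * b * c.
Proof.
have fE : f = x * c by [].
rewrite /dj_cone cform_scale [(f * z) ^+ _]exprMn [f ^+ n.+1]exprSr /dj_curve -/b.
transitivity (f ^+ n * f * (c * (x * z ^+ n.+1 + b) - f * z ^+ n.+1)).
  by ring.
by rewrite {3}fE; ring.
Qed.
End Identities.
End DeJonquieres.

Local Notation x3 := (ord0 : 'I_3).
Local Notation y3 := (lift ord0 (ord0 : 'I_2) : 'I_3).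
Local Notation z3 := (lift ord0 (lift ord0 (ord0 : 'I_1)) : 'I_3).

Lemma ord3_ind (P : 'I_3 -> Prop) : P x3 -> P y3 -> P z3 -> forall i, P i.
Proof.
move=> Px Py Pz i; case: (unliftP ord0 i) => [j|] -> //.
by case: (unliftP ord0 j) => [l|] -> //; rewrite [l]ord1.
Qed.

Definition dj_map n (R : comNzRingType) (x y z : R) : 3.-tuple R :=
  [tuple dj_curve n x y z; dj_factor n x y z * y; dj_factor n x y z * z].

Definition dj_inv n (R : comNzRingType) (x y z : R) : 3.-tuple R :=
  [tuple bform n y z; dj_cone n x y z * y; dj_cone n x y z * z].

Lemma dj_mapE n (R : comNzRingType) (x y z : R) :
  (tnth (dj_map n x y z) x3 = dj_curve n x y z)
  * (tnth (dj_map n x y z) y3 = dj_factor n x y z * y)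
  * (tnth (dj_map n x y z) z3 = dj_factor n x y z * z).
Proof. by []. Qed.

Definition tau n (k : fieldType) : 3.-tuple {mpoly k[3]} :=
  dj_map n 'X_x3 'X_y3 'X_z3.
Definition tau_inv n (k : fieldType) : 3.-tuple {mpoly k[3]} :=
  dj_inv n 'X_x3 'X_y3 'X_z3.

Lemma rmorph_dj_map n (R S : comNzRingType) (f : {rmorphism R -> S}) x y z i :
  f (tnth (dj_map n x y z) i) = tnth (dj_map n (f x) (f y) (f z)) i.
Proof.
by elim/ord3_ind: i; rewrite /= ?rmorphM ?rmorph_dj.
Qed.

Lemma rmorph_dj_inv n (R S : comNzRingType) (f : {rmorphism R -> S}) x y z i :
  f (tnth (dj_inv n x y z) i) = tnth (dj_inv n (f x) (f y) (f z)) i.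
Proof.
by elim/ord3_ind: i; rewrite /= ?rmorphM ?rmorph_dj.
Qed.

Lemma comp_tau n (k : fieldType) m (F : 3.-tuple {mpoly k[m]}) i :
  tnth (tau n k) i \mPo F =
  tnth (dj_map n (tnth F x3) (tnth F y3) (tnth F z3)) i.
Proof. by rewrite rmorph_dj_map /= !comp_mpolyXE. Qed.

Lemma comp_tau_inv n (k : fieldType) m (F : 3.-tuple {mpoly k[m]}) i :
  tnth (tau_inv n k) i \mPo F =
  tnth (dj_inv n (tnth F x3) (tnth F y3) (tnth F z3)) i.
Proof. by rewrite rmorph_dj_inv /= !comp_mpolyXE. Qed.

Section Tau.
Variables (k : fieldType) (hchar : [pchar k] =i pred0) (n : nat).
Let X : {mpoly k[3]} := 'X_x3.
Let Y : {mpoly k[3]} := 'X_y3.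
Let Z : {mpoly k[3]} := 'X_z3.
Let b := bform n Y Z.
Let c := cform n Y Z.
Let K := dj_cone n X Y Z.

Lemma tau_comp_inv i :
  tnth (tau n k) i \mPo tau_inv n k = b * c * K ^+ n.+1 * 'X_i.
Proof.
rewrite comp_tau; elim/ord3_ind: i => /=.
- exact: dj_curve_inverse.
- by rewrite -dj_factor_inverse -mulrA.
- by rewrite -dj_factor_inverse -mulrA.
Qed.

Lemma tau_inv_comp i :
  tnth (tau_inv n k) i \mPo tau n k = dj_factor n X Y Z ^+ n.+1 * b * c * 'X_i.
Proof.
rewrite comp_tau_inv; elim/ord3_ind: i => /=.
- exact: dj_bform_inverse.
- by rewrite -dj_cone_inverse -mulrA.
- by rewrite -dj_cone_inverse -mulrA.
Qed.

Lemma pencil_neq0 m r : pencil m r Y Z != 0.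
Proof.
apply/eqP => /(congr1 (meval (fun i => (i == y3)%:R))).
rewrite rmorph_pencil meval0 /= /Y /Z !mevalXU /=; apply/eqP.
by rewrite pencil10 oner_eq0.
Qed.

Lemma dj_cone_neq0 : K != 0.
Proof.
apply/eqP => /(congr1 (meval (fun i => (i == z3)%:R))).
rewrite rmorph_cone meval0 /X /= /Y /Z !mevalXU /= /dj_cone mulr0 sub0r expr1n.
by apply/eqP; rewrite oppr_eq0 oner_eq0.
Qed.

Lemma bform_homog : b \is n.+2.-homog.
Proof. by rewrite -[n.+2]subn0 dhomog_pencil ?dhomogXU. Qed.

Lemma cform_homog : c \is n.-homog.
Proof. by rewrite -[in X in X.-homog](addKn n.+2 n) dhomog_pencil ?dhomogXU. Qed.

Lemma dj_factor_homog : dj_factor n X Y Z \is n.+1.-homog.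
Proof. by apply: (@dhomogM _ _ _ 1); rewrite ?dhomogXU ?cform_homog. Qed.

Lemma X_homog (i : 'I_3) m : ('X_i ^+ m : {mpoly k[3]}) \is m.-homog.
Proof. by rewrite -[m in X in X.-homog]mul1n; apply/dhomogMn/dhomogXU. Qed.

Lemma dj_curve_homog : dj_curve n X Y Z \is n.+2.-homog.
Proof.
rewrite rpredD ?bform_homog //.
by apply: (@dhomogM _ _ _ 1); rewrite ?dhomogXU ?X_homog.
Qed.

Lemma dj_cone_homog : K \is n.+1.-homog.
Proof.
rewrite rpredB ?X_homog //; apply: (dhomog_cast _ (addn1 _)).
by apply: dhomogM; rewrite ?dhomogXU ?cform_homog.
Qed.

Lemma tau_homog : homogeneous_tuple n.+2 (tau n k).
Proof.
apply: ord3_ind => /=; first exact: dj_curve_homog.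
  by apply: (dhomog_cast _ (addn1 _)); apply: dhomogM; rewrite ?dhomogXU ?dj_factor_homog.
by apply: (dhomog_cast _ (addn1 _)); apply: dhomogM; rewrite ?dhomogXU ?dj_factor_homog.
Qed.

Lemma tau_inv_homog : homogeneous_tuple n.+2 (tau_inv n k).
Proof.
apply: ord3_ind => /=; first exact: bform_homog.
  by apply: (dhomog_cast _ (addn1 _)); apply: dhomogM; rewrite ?dhomogXU ?dj_cone_homog.
by apply: (dhomog_cast _ (addn1 _)); apply: dhomogM; rewrite ?dhomogXU ?dj_cone_homog.
Qed.

Lemma tau_scalar_neq0 : b * c * K ^+ n.+1 != 0.
Proof. by rewrite !mulf_neq0 ?expf_neq0 ?pencil_neq0 ?dj_cone_neq0. Qed.

Lemma tau_inv_scalar_neq0 : dj_factor n X Y Z ^+ n.+1 * b * c != 0.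
Proof.
by rewrite !mulf_neq0 ?expf_neq0 ?mulf_neq0 ?pencil_neq0 ?mpolyX_neq0.
Qed.

Lemma tau_cremona : cremona (tau n k).
Proof.
exact: cremona_of_scalars tau_homog tau_inv_homog tau_scalar_neq0
  tau_inv_scalar_neq0 tau_comp_inv tau_inv_comp.
Qed.

(** In any number of variables, for the plane map and for its pullback to space.
    A common factor divides x c y, and the other coordinates are nonzero at
    suitable points of each line of this product. *)
Lemma dj_map_coprime m (x y z : 'I_m) (q : {mpoly k[m]}) :
  uniq [:: x; y; z] ->
  (forall i, mpoly_divides q (tnth (dj_map n 'X_x 'X_y 'X_z) i)) ->
  q \is a GRing.unit.
Proof.
rewrite /= !inE !negb_or andbT -andbA => /and3P[xy xz yz] hq.
pose pt (r s t : k) (i : 'I_m) : k :=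
  if i == x then r else if i == y then s else if i == z then t else 0.
have ptx r s t : pt r s t x = r by rewrite /pt eqxx.
have pty r s t : pt r s t y = s by rewrite /pt eq_sym (negbTE xy) eqxx.
have ptz r s t : pt r s t z = t.
  by rewrite /pt eq_sym (negbTE xz) eq_sym (negbTE yz) eqxx.
have ev i r s t : tnth (dj_map n r s t) i != 0 -> q.@[pt r s t] != 0.
  move=> ne0; apply: mpoly_divides_meval (hq i) _.
  by rewrite rmorph_dj_map /= !mevalXU ptx pty ptz.
apply: unit_of_coprime_divides (hq y3); do !apply: coprime_toM.
- apply: coprime_to_var; exists (pt 0 1 0); first exact: ptx.
  by apply: (ev x3); rewrite dj_mapE /dj_curve mul0r add0r /bform pencil10 oner_eq0.
- apply: coprime_to_pencil => // i /andP[hi _].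
  exists (pt 0 i.+1%:R 1); first by rewrite pty ptz mulr1.
  apply: (ev x3); rewrite dj_mapE /dj_curve mul0r add0r pencil_nat_eq0 //.
  by rewrite ltnNge hi.
apply: coprime_to_var; exists (pt 1 0 1); first exact: pty.
by apply: (ev z3); rewrite dj_mapE mulr1 /dj_factor mul1r pencil01_neq0.
Qed.

Lemma tau_no_common_factor : no_common_factor (tau n k).
Proof. by move=> q hq; apply: (@dj_map_coprime 3 x3 y3 z3 q). Qed.

Lemma poly_in_pencil m (i y z : 'I_m) r s : y != i -> z != i ->
  poly_in i (pencil r s 'X_y 'X_z : {mpoly k[m]}) = (pencil r s 'X_y 'X_z)%:P.
Proof.
move=> yi zi.
have := @rmorph_pencil {mpoly k[m]} {poly {mpoly k[m]}} (poly_in i) r s 'X_y 'X_z.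
rewrite /= !poly_inX (negbTE yi) (negbTE zi) => e; apply: (etrans e).
exact/esym/(rmorph_pencil polyC).
Qed.

Lemma dj_curve_irreducible : mpoly_irreducible (dj_curve n X Y Z).
Proof.
apply: mpoly_irreducible_linear.
- by rewrite !rmorphXn /= poly_inX.
- exact: poly_in_pencil.
- by rewrite expf_neq0 ?mpolyX_neq0.
move=> q qz qb; apply: unit_of_coprime_divides qz.
apply/coprime_toX/coprime_to_var; exists (fun i => (i == y3)%:R) => //.
apply: mpoly_divides_meval qb _.
by rewrite rmorph_bform /= /Y /Z !mevalXU /= /bform pencil10 oner_eq0.
Qed.
End Tau.

(** * Base points *)

Definition point3 (k : fieldType) (a b c : k) : 'rV[k]_3 :=
  \row_i tnth [tuple a; b; c] i.

Lemma point3E (k : fieldType) (a b c : k) :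
  (point3 a b c 0 x3 = a) * (point3 a b c 0 y3 = b) * (point3 a b c 0 z3 = c).
Proof. by rewrite !mxE. Qed.

Lemma member_delta (k : fieldType) (m n : nat) (F : m.-tuple {mpoly k[n]}) i :
  \sum_(j < m) (delta_mx 0 i : 'rV[k]_m) 0 j *: tnth F j = tnth F i.
Proof.
rewrite (bigD1 i) //= mxE !eqxx scale1r big1 ?addr0 // => j ji.
by rewrite mxE eqxx (negbTE ji) scale0r.
Qed.

(** A lower bound for the generators holds for all members, so one generator that
    attains it is enough. *)
Lemma linear_system_mult_member (k : fieldType) (m n d r : nat)
    (F : m.-tuple {mpoly k[n.+1]}) (p : 'rV[k]_n.+1) (i : 'I_m) :
  homogeneous_tuple d F -> p != 0 -> tnth F i != 0 ->
  (forall j l, (mdeg l < r)%N -> (local_equation (tnth F j) p)@_l = 0) ->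
  (mult (tnth F i) p <= r)%N ->
  linear_system_mult F p r.
Proof.
move=> hF p0 Fi0 hr hi; split=> [a|].
  move=> a0; apply: (mult_ge (d := d)) => // [|l lr].
    by apply: rpred_sum => j _; apply: dhomogZ.
  rewrite /local_equation (raddf_sum (comp_mpoly _)) raddf_sum big1 // => j _.
  by rewrite /= comp_mpolyZ mcoeffZ [X in _ * X]hr ?mulr0.
exists (delta_mx 0 i); rewrite member_delta //.
by apply/eqP; rewrite eqn_leq hi (mult_ge (hF i)) // => l; apply: hr.
Qed.

Section Points.
Variables (k : fieldType) (hchar : [pchar k] =i pred0) (n : nat).

(** Here x a + b = 0 because a = 1, and x c = - b c = 0 because the slope j + 1 is
    a root of b c, if j < 2 n + 2.  For j < n + 2 it is a root of b, and the point lies on x = 0. *)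
Definition base_point (j : nat) : 'rV[k]_3 :=
  point3 (- bform n j.+1%:R 1) j.+1%:R 1.

Definition vertex : 'rV[k]_3 := point3 1 0 0.

Lemma base_point_neq0 j : base_point j != 0.
Proof.
apply/eqP => /rowP/(_ z3); rewrite point3E mxE => /eqP.
by rewrite oner_eq0.
Qed.

Lemma vertex_neq0 : vertex != 0.
Proof.
by apply/eqP => /rowP/(_ x3); rewrite point3E mxE => /eqP; rewrite oner_eq0.
Qed.

Lemma chart_vertex : chart_at vertex = x3.
Proof.
have := chart_atP vertex_neq0.
by elim/ord3_ind: (chart_at _); rewrite // point3E eqxx.
Qed.

Lemma tau_neq0 i : tnth (tau n k) i != 0.
Proof.
apply: contraNneq (mulf_neq0 (tau_scalar_neq0 k n) (mpolyX_neq0 k i)) => t0.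
by rewrite -tau_comp_inv t0 comp_mpoly0.
Qed.

Lemma tau_base_point i j : (j < n.+2 + n)%N ->
  (tnth (tau n k) i).@[base_point j 0] = 0.
Proof.
move=> jn; rewrite rmorph_dj_map /= !mevalXU !point3E.
have bc : bform n j.+1%:R 1 * cform n j.+1%:R 1 = 0 :> k.
  by apply/eqP; rewrite -pencil_cat ?leq_addr // pencil_nat_eq0.
elim/ord3_ind: i; rewrite dj_mapE /dj_curve /dj_factor ?expr1n ?mulr1 ?addNr //.
  by rewrite mulNr bc oppr0 mul0r.
by rewrite mulNr bc oppr0.
Qed.

Lemma mmap_tau (p : 'rV[k]_3) (v : 'I_3 -> k) i :
  mmap (@polyC k) (fun j => (p 0 j)%:P + v j *: 'X) (tnth (tau n k) i) =
  tnth (dj_map n ((p 0 x3)%:P + v x3 *: 'X) ((p 0 y3)%:P + v y3 *: 'X)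
    ((p 0 z3)%:P + v z3 *: 'X)) i.
Proof.
by rewrite (rmorph_dj_map n (mmap (@polyC k) _)) /= !mmapX !mmap1U.
Qed.


Lemma chart_base_point_gt0 j : (j < n.+2)%N -> chart_at (base_point j) != x3.
Proof.
move=> jn; apply: contraTneq (chart_atP (base_point_neq0 j)) => ->.
by rewrite point3E oppr_eq0 pencil_nat_eq0 // jn.
Qed.

(** A member of the system is simple at the point if it restricts to order one
    along a direction in the chart.  Unless the chart is x = p_x, the direction of x
    works for x a + b.  In that chart p_x is nonzero, so the slope is a simple root
    of c, and the direction of y works for x c z. *)
Lemma tau_mult_base_point j : (j < n.+2 + n)%N ->
  linear_system_mult (tau n k) (base_point j) 1.
Proof.
move=> jn; have sysE i := linear_system_mult_member (r := 1) (i := i)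
  (tau_homog k n) (base_point_neq0 j) (tau_neq0 i).
have low i l : (mdeg l < 1)%N ->
    (local_equation (tnth (tau n k) i) (base_point j))@_l = 0.
  by apply: local_equation_coef0; apply: tau_base_point.
have [c0|c0] := eqVneq (chart_at (base_point j)) x3.
  have jn2 : (n.+2 <= j)%N.
    by rewrite leqNgt; apply/negP => /chart_base_point_gt0; rewrite c0.
  apply: (sysE z3 low); apply: (mult_le (v := fun i => (i == y3)%:R)).
    by rewrite c0.
  rewrite mmap_tau dj_mapE !point3E /= !scale0r !addr0 scale1r mulr1.
  rewrite /dj_factor coefCM mulf_neq0 ?pencil_simple_root ?jn2 //.
  by rewrite oppr_eq0 pencil_nat_eq0 // ltnNge jn2.
apply: (sysE x3 low); apply: (mult_le (v := fun i => (i == x3)%:R)).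
  by rewrite (negbTE c0).
rewrite mmap_tau dj_mapE !point3E /= !scale0r !addr0 scale1r /dj_curve.
rewrite expr1n mulr1 /bform -(rmorph_pencil polyC) addrAC -polyCD coefD coefC.
by rewrite coefX add0r oner_eq0.
Qed.

Lemma local_equation_vertex (i : 'I_3) :
  local_equation (tnth (tau n k) i) vertex =
  tnth (dj_map n 1 'X_y3 'X_z3) i.
Proof.
rewrite /local_equation comp_tau !tnth_mktuple chart_vertex !point3E /=.
by rewrite mpolyC0 !add0r addr0.
Qed.

Lemma local_equation_vertex_coef (i : 'I_3) l : (mdeg l < n.+1)%N ->
  (local_equation (tnth (tau n k) i) vertex)@_l = 0.
Proof.
move=> hl; rewrite local_equation_vertex.
have hc (j : 'I_3) : (cform n 'X_y3 'X_z3 * 'X_j : {mpoly k[3]})@_l = 0.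
  apply: (dhomog_coef_lt (e := n + 1) _ _ hl); last by rewrite addn1.
  by apply: dhomogM; [apply: cform_homog|apply: dhomogXU].
elim/ord3_ind: i; rewrite dj_mapE /dj_factor ?mul1r //.
rewrite /dj_curve mul1r mcoeffD (dhomog_coef_lt (X_homog _ _ _) _ hl) //.
by rewrite (dhomog_coef_lt (bform_homog _ _) _ hl) ?addr0.
Qed.

Lemma dj_curve_mult_vertex_le : (mult (tnth (tau n k) x3) vertex <= n.+1)%N.
Proof.
apply: (mult_le (v := fun i => (i == z3)%:R)); first by rewrite chart_vertex.
rewrite mmap_tau dj_mapE !point3E /= !scale0r !addr0 scale1r polyC0 add0r.
rewrite /dj_curve mul1r /bform.
have -> : pencil 0 n.+2 0 'X = 'X ^+ n.+2 * pencil 0 n.+2 0 1 :> {poly k}.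
  by have := pencil_scale ('X : {poly k}) 0 n.+2 0 1; rewrite mulr0 mulr1 subn0.
by rewrite coefD coefXn eqxx coefXnM ltnSn addr0 oner_eq0.
Qed.

Lemma tau_mult_vertex : linear_system_mult (tau n k) vertex n.+1.
Proof.
apply: (linear_system_mult_member (tau_homog k n) vertex_neq0 (tau_neq0 x3)).
  exact: local_equation_vertex_coef.
exact: dj_curve_mult_vertex_le.
Qed.

Lemma dj_curve_mult_vertex : mult (tnth (tau n k) x3) vertex = n.+1.
Proof.
apply/eqP; rewrite eqn_leq dj_curve_mult_vertex_le.
apply: (mult_ge (tau_homog k n x3) (tau_neq0 x3) vertex_neq0).
exact: local_equation_vertex_coef.
Qed.

Lemma dj_factor_neq0 : dj_factor n 'X_x3 'X_y3 'X_z3 != 0 :> {mpoly k[3]}.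
Proof. by rewrite mulf_neq0 ?mpolyX_neq0 ?pencil_neq0. Qed.

Lemma dj_factor_mult_vertex :
  (n <= mult (dj_factor n 'X_x3 'X_y3 'X_z3 : {mpoly k[3]}) vertex)%N.
Proof.
apply: (mult_ge (dj_factor_homog k n) dj_factor_neq0 vertex_neq0) => l hl.
rewrite /local_equation rmorph_factor /= !comp_mpolyXE !tnth_mktuple.
rewrite chart_vertex !point3E /= mpolyC0 !add0r addr0 /dj_factor mul1r.
exact: dhomog_coef_lt (cform_homog k n) _ hl.
Qed.

Definition base_points (i : 'I_(2 * n.+2 - 2).+1) : 'rV[k]_3 :=
  if unlift ord0 i is Some j then base_point j else vertex.

Lemma base_points_lt (j : 'I_(2 * n.+2 - 2)) : (j < n.+2 + n)%N.
Proof. by case: j => j /= hj; lia. Qed.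

Lemma base_points_distinct : distinct_points base_points.
Proof.
split=> [i|i j ij].
  rewrite /base_points; case: unlift => [l|]; first exact: base_point_neq0.
  exact: vertex_neq0.
have vb l : ~~ (vertex <= base_point l)%MS.
  apply/negP => /sub_rVP[a e]; have := congr1 (fun p : 'rV_3 => p 0 z3) e.
  rewrite [LHS]point3E mxE point3E mulr1 => a0.
  have := congr1 (fun p : 'rV_3 => p 0 x3) e; rewrite [LHS]point3E mxE point3E -a0 mul0r.
  by move/eqP; rewrite oner_eq0.
rewrite /base_points; case: (unliftP ord0 i) => [l|] ei;
    case: (unliftP ord0 j) => [m|] ej; try by rewrite negb_and vb ?orbT.
  apply: contra ij => /andP[/sub_rVP[a e] _].
  have := congr1 (fun p : 'rV_3 => p 0 z3) e.
  rewrite [LHS]point3E mxE point3E mulr1 => a1.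
  have := congr1 (fun p : 'rV_3 => p 0 y3) e; rewrite [LHS]point3E mxE point3E -a1 mul1r.
  move/eqP; rewrite natr_eq // eqSS => /eqP/val_inj lm.
  by rewrite ei ej lm.
by case/eqP: ij; rewrite ei ej.
Qed.

Lemma base_points_condition_I : condition_I base_points.
Proof.
exists (dj_curve n 'X_x3 'X_y3 'X_z3), (dj_factor n 'X_x3 'X_y3 'X_z3).
have e0 : base_points ord0 = vertex by rewrite /base_points unlift_none.
rewrite !subSS !subn0 e0; split.
- split; last exact: dj_curve_irreducible.
  by split; [apply: (tau_neq0 x3)|apply: dj_curve_homog].
- by split; [apply: dj_factor_neq0|apply: dj_factor_homog].
- exact: dj_curve_mult_vertex.
- exact: dj_factor_mult_vertex.
move=> i; rewrite /base_points liftK; have hi := base_points_lt i.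
split; first exact: (tau_base_point x3 hi).
have := tau_base_point z3 hi; rewrite dj_mapE mevalM mevalXU point3E mulr1.
by [].
Qed.

Lemma tau_admissible : admissible_tau n.+2 (tau n k).
Proof.
exists base_points; split.
- exact: base_points_distinct.
- exact: base_points_condition_I.
split.
- exact: tau_cremona.
- exact: tau_homog.
- exact: tau_no_common_factor.
- by rewrite /base_points unlift_none subSS subn0; apply: tau_mult_vertex.
move=> i; rewrite /base_points liftK; apply: tau_mult_base_point.
exact: base_points_lt.
Qed.

End Points.

(** * Transformations of space *)

Lemma poly_in_inclusion (k : fieldType) (f : {mpoly k[3]}) :
  poly_in ord0 (inclusion_xyz f) = (inclusion_xyz f)%:P.
Proof.
apply: (mpoly_morph_eq (f := @poly_in k 4 ord0 \o @inclusion_xyz k)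
  (g := polyC \o @inclusion_xyz k)) => [c|i] /=.
  by rewrite /inclusion_xyz comp_mpolyC [LHS]mmapC.
by rewrite inclusionX poly_inX.
Qed.

Lemma inclusion_meval (k : fieldType) (f : {mpoly k[3]}) (v : 'I_4 -> k) :
  (inclusion_xyz f).@[v] = f.@[fun i => v (lift ord0 i)].
Proof.
rewrite comp_mpoly_meval; apply: meval_eq => i.
by rewrite tnth_mktuple mevalXU.
Qed.

(** In the plane w = 0, where the coordinate W h - B of [T_inverse] restricts
    to - B. *)
Definition space_point (k : fieldType) (a b c : k) (i : 'I_4) : k :=
  if unlift ord0 i is Some j then point3 a b c 0 j else 0.

Lemma inclusion_space_point (k : fieldType) (f : {mpoly k[3]}) (a b c : k) :
  (inclusion_xyz f).@[space_point a b c] = f.@[point3 a b c 0].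
Proof.
rewrite inclusion_meval; apply: meval_eq => i.
by rewrite /space_point liftK.
Qed.

Section Space.
Variables (k : fieldType) (hchar : [pchar k] =i pred0) (n : nat).
Let X : {mpoly k[3]} := 'X_x3.
Let Y : {mpoly k[3]} := 'X_y3.
Let Z : {mpoly k[3]} := 'X_z3.
Let b := bform n Y Z.
Let c := cform n Y Z.
Let K := dj_cone n X Y Z.

Lemma coprime_to_inclusion_var (q : {mpoly k[4]}) (i : 'I_3) (r s t : k) :
  point3 r s t 0 i = 0 -> q.@[space_point r s t] != 0 ->
  coprime_to q (inclusion_xyz 'X_i).
Proof.
move=> h0 hq; rewrite inclusionX; apply: coprime_to_var.
by exists (space_point r s t); rewrite // /space_point liftK.
Qed.

Lemma coprime_to_inclusion_pencil (q : {mpoly k[4]}) l r (a : nat -> k) :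
  (forall i, (l <= i < r)%N -> q.@[space_point (a i) i.+1%:R 1] != 0) ->
  coprime_to q (inclusion_xyz (pencil l r Y Z)).
Proof.
move=> hq; rewrite rmorph_pencil /= !inclusionX.
apply: coprime_to_pencil => // i /hq hi; exists (space_point (a i) i.+1%:R 1) => //.
by rewrite /space_point !liftK !point3E mulr1.
Qed.

(** The absence of common factors in [T_inverse] says that l is the greatest common
    divisor of h, A(s) and B(s); then e + 1 is the degree of the inverse. *)
Lemma T_map_cremona (A B A' B' h' l : {mpoly k[3]}) (e : nat) :
  A \is n.+1.-homog -> B \is n.+2.-homog -> A != 0 ->
  (forall q, mpoly_divides q (inclusion_xyz A) ->
    mpoly_divides q (inclusion_xyz B) -> q \is a GRing.unit) ->
  A \mPo tau_inv n k = l * A' -> B \mPo tau_inv n k = l * B' ->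
  b * c * K ^+ n.+1 = l * h' ->
  h' \is e.-homog -> B' \is e.+1.-homog ->
  (forall i, A' * tnth (tau_inv n k) i \is e.+1.-homog) ->
  no_common_factor (T_inverse h' A' B' (tau_inv n k)) ->
  exists (g : {mpoly k[4]}) (t : 3.-tuple {mpoly k[3]}),
    [/\ admissible_g n.+2 g, admissible_tau n.+2 t
      & cremona_of_bidegree (T_map g t) n.+2 e.+1].
Proof.
move=> hA hB A0 AB eA eB eh hh' hB' hA' ncf.
have iA0 : inclusion_xyz A != 0.
  by apply: contra_neq A0 => iA; apply: inclusion_inj; rewrite iA rmorph0.
exists ('X_ord0 * inclusion_xyz A + inclusion_xyz B), (tau n k); split.
- split; last by exists A, B; split=> //; rewrite subSS subn0.
  by apply: mpoly_irreducible_linear => //; apply: poly_in_inclusion.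
- exact: tau_admissible.
have hG := T_inverse_homog hh' hB' hA'.
have inv := T_map_inverse (tau_homog k n) hA hB A0
  (tau_scalar_neq0 k n) (tau_inv_scalar_neq0 k n) (tau_comp_inv k n)
  (tau_inv_comp k n) eA eB eh hG.
exists (T_inverse h' A' B' (tau_inv n k)); case: (inv) => hT hTi _ _.
split=> //; last first.
  by exists (T_inverse h' A' B' (tau_inv n k)); split=> //; apply: same_ratmap_refl.
eexists; split; first exact: same_ratmap_refl.
  by apply: T_map_homog (tau_homog k n); rewrite dhomog_linear_w ?dhomog_inclusion.
move=> q hq; apply: (dj_map_coprime hchar (n := n) (x := lift ord0 x3)
  (y := lift ord0 y3) (z := lift ord0 z3)) => // i.
have := hq (lift ord0 i); rewrite tnthS tnth_map rmorph_dj_map /=.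
by rewrite !inclusionX.
Qed.

Lemma T_inverse_meval (h A B : {mpoly k[3]}) (s : 3.-tuple {mpoly k[3]})
    (r y z : k) :
  (tnth (T_inverse h A B s) ord0).@[space_point r y z] =
  - B.@[point3 r y z 0].
Proof.
rewrite tnth0 mevalB mevalM mevalXU {1}/space_point unlift_none mul0r sub0r.
by rewrite inclusion_space_point.
Qed.

Lemma divides_T_inverse (h A B : {mpoly k[3]}) (s : 3.-tuple {mpoly k[3]}) q i :
  mpoly_divides q (tnth (T_inverse h A B s) (lift ord0 i)) ->
  mpoly_divides q (inclusion_xyz (A * tnth s i)).
Proof. by rewrite tnthS tnth_map tnth_mktuple. Qed.

Lemma dj_cone_pt_affine j : dj_cone n 0 j.+1%:R 1 = -1 :> k.
Proof. by rewrite /dj_cone mulr0 sub0r expr1n. Qed.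

Lemma dj_cone_pt_infty : dj_cone n 1 1 0 = 1 :> k.
Proof. by rewrite /dj_cone /cform pencil10 expr0n /= subr0 mulr1. Qed.

Lemma natS_neq0 j : j.+1%:R != 0 :> k.
Proof. by rewrite ((pcharf0P k).1 hchar). Qed.

Lemma comp_tau_invE :
  (X \mPo tau_inv n k = b) * (Y \mPo tau_inv n k = K * Y)
  * (Z \mPo tau_inv n k = K * Z).
Proof. by rewrite !comp_mpolyXE. Qed.

Lemma pencil_comp_tau_inv l r :
  pencil l r Y Z \mPo tau_inv n k = K ^+ (r - l) * pencil l r Y Z.
Proof. by rewrite rmorph_pencil /= !comp_tau_invE pencil_scale. Qed.

Lemma bform_split r : (r <= n.+2)%N -> b = pencil 0 r Y Z * pencil r n.+2 Y Z.
Proof. by move=> rn; apply: pencil_cat. Qed.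

(** A(s) = b^(n+1-j) (K z)^j contains every line of b, because A vanishes on the
    line x = 0, and B(s) selects r of them. *)
Lemma cremona_low_vertex (j r : nat) : (j <= n)%N -> (r <= n.+2)%N ->
  exists (g : {mpoly k[4]}) (t : 3.-tuple {mpoly k[3]}),
    [/\ admissible_g n.+2 g, admissible_tau n.+2 t
      & cremona_of_bidegree (T_map g t) n.+2 (n.+2 ^ 2 - n.+1 * j - r)].
Proof.
move=> jn rn; set e := (_ - r)%N.
have [e1 ee] : exists e1, e = e1.+1 by exists e.-1; rewrite prednK //; nia.
have bE : b = pencil 0 r Y Z * pencil r n.+2 Y Z by apply: pencil_cat.
pose A' := b ^+ (n - j) * pencil r n.+2 Y Z * Z ^+ j.
pose B' := K ^+ (n.+2 - j) * Y ^+ (n.+2 - r).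
pose h' := pencil r n.+2 Y Z * c * K ^+ (n.+1 - j).
rewrite ee; apply: (@T_map_cremona (X ^+ (n.+1 - j) * Z ^+ j)
  (pencil 0 r Y Z * Y ^+ (n.+2 - r)) A' B' h' (K ^+ j * pencil 0 r Y Z)).
- apply: (dhomog_cast (dhomogM (X_homog _ _ _) (X_homog _ _ _))).
  by rewrite subnK // ltnW.
- apply: (dhomog_cast (dhomogM (dhomog_pencil _ _ _ _) (X_homog _ _ _)));
    rewrite ?dhomogXU //; lia.
- by rewrite mulf_neq0 ?expf_neq0 ?mpolyX_neq0.
- move=> q qA qB.
  have q0 : q.@[space_point 0 1 0] != 0.
    apply: mpoly_divides_meval qB _; rewrite inclusion_space_point.
    rewrite mevalM rmorphXn rmorph_pencil /= /Y /Z !mevalXU !point3E.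
    by rewrite pencil10 expr1n mulr1 oner_eq0.
  apply: unit_of_coprime_divides qA; rewrite rmorphM !rmorphXn.
  by apply: coprime_toM; apply: coprime_toX;
    apply: coprime_to_inclusion_var q0; rewrite point3E.
- rewrite rmorphM !rmorphXn /= !comp_tau_invE subSn // exprS exprMn.
  by rewrite {1}bE /A'; ring.
- rewrite rmorphM rmorphXn /= pencil_comp_tau_inv comp_tau_invE exprMn subn0.
  have KE : K ^+ r * K ^+ (n.+2 - r) = K ^+ j * K ^+ (n.+2 - j).
    by rewrite -!exprD !subnKC // ltnW // ltnW.
  transitivity (K ^+ r * K ^+ (n.+2 - r) * pencil 0 r Y Z * Y ^+ (n.+2 - r)).
    by ring.
  by rewrite KE /B'; ring.
- have KE : K ^+ n.+1 = K ^+ j * K ^+ (n.+1 - j).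
    by rewrite -exprD subnKC // ltnW.
  by rewrite KE bE /h'; ring.
- apply: dhomog_cast (dhomogM (dhomogM (dhomog_pencil _ _ _ _)
    (cform_homog k n)) (dhomogMn _ (dj_cone_homog k n))) _; rewrite ?dhomogXU //.
  by nia.
- apply: dhomog_cast (dhomogM (dhomogMn _ (dj_cone_homog k n)) (X_homog _ _ _)) _.
  by nia.
- move=> i; apply: dhomog_cast (dhomogM (dhomogM (dhomogM
    (dhomogMn _ (bform_homog k n)) (dhomog_pencil _ _ _ _)) (X_homog _ _ _))
    (tau_inv_homog k n i)) _; rewrite ?dhomogXU //.
  by nia.
move=> q hq.
have qb i : q.@[space_point 0 i.+1%:R 1] != 0.
  apply: mpoly_divides_meval (hq ord0) _; rewrite T_inverse_meval oppr_eq0.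
  rewrite mevalM !rmorphXn rmorph_cone /= /X /Y /Z !mevalXU !point3E.
  by rewrite dj_cone_pt_affine mulf_neq0 ?expf_neq0 ?natS_neq0 ?oppr_eq0 ?oner_eq0.
have qz : q.@[space_point 1 1 0] != 0.
  apply: mpoly_divides_meval (hq ord0) _; rewrite T_inverse_meval oppr_eq0.
  rewrite mevalM !rmorphXn rmorph_cone /= /X /Y /Z !mevalXU !point3E.
  by rewrite dj_cone_pt_infty !expr1n mulr1 oner_eq0.
apply: unit_of_coprime_divides (divides_T_inverse (hq (lift ord0 x3))).
have cb l : coprime_to q (inclusion_xyz (pencil l n.+2 Y Z)).
  exact: (coprime_to_inclusion_pencil (a := fun=> 0)).
rewrite !(rmorphM (@inclusion_xyz k)) !(rmorphXn (@inclusion_xyz k)) /=.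
do !apply: coprime_toM; do ?apply: coprime_toX; do ?exact: cb.
by apply: coprime_to_inclusion_var qz; rewrite point3E.
Qed.

(** A and B both have multiplicity n + 1 at the vertex; now B(s) contains every
    line of b, because B vanishes on the line x = 0, and A(s) selects r of them. *)
Lemma cremona_high_vertex (r : nat) : (r <= n.+1)%N ->
  exists (g : {mpoly k[4]}) (t : 3.-tuple {mpoly k[3]}),
    [/\ admissible_g n.+2 g, admissible_tau n.+2 t
      & cremona_of_bidegree (T_map g t) n.+2 (2 * n.+2 - 1 - r)].
Proof.
move=> rn; have rn2 := leqW rn.
have ee : (2 * n.+2 - 1 - r = (n.+2 + n - r).+1)%N by lia.
have bE := bform_split rn2.
pose A' := Z ^+ (n.+1 - r).
pose B' := pencil r n.+2 Y Z * Y ^+ n.+1.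
pose h' := pencil r n.+2 Y Z * c.
rewrite ee; apply: (@T_map_cremona (pencil 0 r Y Z * Z ^+ (n.+1 - r))
  (X * Y ^+ n.+1) A' B' h' (K ^+ n.+1 * pencil 0 r Y Z)).
- apply: (dhomog_cast (dhomogM (dhomog_pencil _ _ _ _) (X_homog _ _ _)));
    rewrite ?dhomogXU //; lia.
- by apply: (dhomog_cast (dhomogM (dhomogXU _ _) (X_homog _ _ _))).
- by rewrite mulf_neq0 ?expf_neq0 ?mpolyX_neq0 ?pencil_neq0.
- move=> q qA qB.
  have qy (y z : k) : y != 0 -> q.@[space_point 1 y z] != 0.
    move=> y0; apply: mpoly_divides_meval qB _; rewrite inclusion_space_point.
    rewrite mevalM rmorphXn /= /X /Y !mevalXU !point3E.
    by rewrite mul1r expf_neq0.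
  apply: unit_of_coprime_divides qA; rewrite rmorphM rmorphXn /=.
  apply: coprime_toM; last first.
    apply: coprime_toX; apply: (coprime_to_inclusion_var (r := 1) (s := 1) (t := 0)).
      by rewrite point3E.
    by rewrite qy ?oner_eq0.
  by apply: (coprime_to_inclusion_pencil (a := fun=> 1)) => i _; rewrite qy ?natS_neq0.
- rewrite rmorphM rmorphXn /= pencil_comp_tau_inv comp_tau_invE exprMn subn0.
  have KE : K ^+ r * K ^+ (n.+1 - r) = K ^+ n.+1.
    by rewrite -exprD subnKC.
  by rewrite -KE /A'; ring.
- by rewrite rmorphM rmorphXn /= !comp_tau_invE exprMn bE /B'; ring.
- by rewrite bE /h'; ring.
- apply: dhomog_cast (dhomogM (dhomog_pencil _ _ _ _)
    (cform_homog k n)) _; rewrite ?dhomogXU //; lia.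
- apply: dhomog_cast (dhomogM (dhomog_pencil _ _ _ _) (X_homog _ _ _)) _;
    rewrite ?dhomogXU //; lia.
- move=> i; apply: dhomog_cast (dhomogM (X_homog _ _ _) (tau_inv_homog k n i)) _.
  by lia.
move=> q hq.
have qb i : q.@[space_point 0 i.+1%:R 1] != 0.
  have := divides_T_inverse (hq (lift ord0 y3)) => h.
  apply: mpoly_divides_meval h _; rewrite inclusion_space_point.
  rewrite mevalM rmorphXn mevalM rmorph_cone /= /X /Y /Z !mevalXU !point3E.
  rewrite dj_cone_pt_affine expr1n mul1r mulN1r oppr_eq0.
  exact: natS_neq0.
have qz : q.@[space_point 0 1 0] != 0.
  apply: mpoly_divides_meval (hq ord0) _; rewrite T_inverse_meval oppr_eq0.
  rewrite mevalM rmorphXn rmorph_pencil /= /Y /Z !mevalXU !point3E.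
  by rewrite pencil10 expr1n mulr1 oner_eq0.
apply: unit_of_coprime_divides (divides_T_inverse (hq (lift ord0 x3))).
rewrite (rmorphM (@inclusion_xyz k)) (rmorphXn (@inclusion_xyz k)) /=.
apply: coprime_toM; last exact: (coprime_to_inclusion_pencil (a := fun=> 0)).
by apply/coprime_toX; apply: coprime_to_inclusion_var qz; rewrite point3E.
Qed.

End Space.

Local Close Scope ring_scope.

Theorem lemma2 (k : closedFieldType) (hchar : [pchar k]%R =i pred0)
    (d : nat) (hd : 2 <= d) :
  (forall m : nat, m <= d - 1 ->
     exists (g : {mpoly k[4]}) (tau : 3.-tuple {mpoly k[3]}),
       [/\ admissible_g d g, admissible_tau d tau
         & cremona_of_bidegree (T_map g tau) d (2 * d - 1 - m)]) /\
  (forall l m : nat, l < d - 1 -> m <= 2 * d - 2 ->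
     exists (g : {mpoly k[4]}) (tau : 3.-tuple {mpoly k[3]}),
       [/\ admissible_g d g, admissible_tau d tau
         & cremona_of_bidegree (T_map g tau) d (d ^ 2 - l ^ 2 - m)]).
Proof.
case: d hd => [|[|n]] // _; split=> [m hm|l m hl hm].
  by apply: cremona_high_vertex; rewrite // subSS subn0 in hm *.
have hn : l ^ 2 + m <= n.+1 * n + n.+2 by rewrite -mulnn in hm *; nia.
have [j [r [jn rn jr]]] : exists j r,
    [/\ j <= n, r <= n.+2 & n.+1 * j + r = l ^ 2 + m].
  (* Euclidean division gives remainders below d - 1; the largest quotient d - 2
     is kept for the two values beyond, at the price of r <= d. *)
  have [small|large] := ltnP (l ^ 2 + m) (n.+1 * n.+1).
    exists ((l ^ 2 + m) %/ n.+1), ((l ^ 2 + m) %% n.+1); split.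
    - by rewrite -ltnS ltn_divLR.
    - exact: leq_trans (ltnW (ltn_pmod _ (ltn0Sn n))) (leqnSn _).
    - by rewrite mulnC -divn_eq.
  exists n, (l ^ 2 + m - n.+1 * n); split=> //; lia.
have -> : n.+2 ^ 2 - l ^ 2 - m = n.+2 ^ 2 - n.+1 * j - r.
  by rewrite -!subnDA jr.
exact: cremona_low_vertex.
Qed.
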